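(* The class of multi-path matroids is closed under duality and under taking minors, and it properly contains the class of lattice path matroids.
   Context: A set system on a finite set $S$ is a multiset $\mathcal{A}=(A_j:j\in J)$ of subsets of $S$. A partial transversal of $\mathcal{A}$ is a set $\{x_k:k\in K\}$ of $|K|$ distinct elements, for some $K\subseteq J$, with $x_k\in A_k$ for all $k\in K$. The partial transversals are the independent sets of a matroid $M[\mathcal{A}]$ on $S$; such matroids are transversal matroids and $\mathcal{A}$ is a presentation of $M[\mathcal{A}]$. Let $\sigma$ be a cyclic permutation of $S$. A $\sigma$-interval is a nonempty subset $I\subseteq S$ of the form $\{f_I,\sigma(f_I),\sigma^2(f_I),\ldots,l_I\}$, written $[f_I,l_I]$; $f_I$ and $l_I$ are its first and last elements. A set system is an antichain if no member contains another member. A multi-path matroid is a transversal matroid having a presentation by an antichain of $\sigma$-intervals for some cyclic permutation $\sigma$ of its ground set. Lattice path matroids: for lattice paths $P,Q$ from $(0,0)$ to $(m,r)$ using steps $E=(1,0)$ and $N=(0,1)$, with $P$ never above $Q$, let $\mathcal{P}$ be the set of such lattice paths from $(0,0)$ to $(m,r)$ going neither above $Q$ nor below $P$; for $1\le i\le r$ let $N_i$ be the set of $j$ such that the $j$-th step of some path in $\mathcal{P}$ is its $i$-th North step. $M[P,Q]$ is the transversal matroid on $[m+r]$ with presentation $(N_1,\ldots,N_r)$, and a lattice path matroid is any matroid isomorphic to some $M[P,Q]$. *)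

(* Defs.v *)
From HB Require Import structures.
From mathcomp Require Import all_boot all_order all_fingroup.

Set Implicit Arguments.
Unset Strict Implicit.
Unset Printing Implicit Defensive.

(* The ground set is a subset of a finite type, so that minors of a matroid   *)
(* over T are again matroids over T.                                          *)
Record matroid (T : finType) := Matroid {
  ground : {set T};
  indep : {set {set T}};
  indep_ground : forall X : {set T}, X \in indep -> X \subset ground;
  indep0 : set0 \in indep;
  indep_sub : forall X Y : {set T}, X \subset Y -> Y \in indep -> X \in indep;
  indep_aug : forall X Y : {set T}, X \in indep -> Y \in indep -> #|X| < #|Y| ->
    exists2 y, y \in Y :\: X & y |: X \in indep
}.

Section Matroids.
Variable T : finType.
Implicit Types (M N : matroid T) (X Y B I J : {set T}).

Definition basis M B := maxset (fun X => X \in indep M) B.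

(* Equality of matroids, irrespective of the proofs of the axioms. *)
Definition eqmatroid M N := ground M = ground N /\ indep M = indep N.

Lemma indep_extend M X Y : X \in indep M -> Y \in indep M -> #|X| <= #|Y| ->
  exists2 Z, Z \in indep M & [/\ X \subset Z, Z \subset X :|: Y & #|Z| = #|Y|].
Proof.
move=> + iY; move: {2}(#|Y| - #|X|) (leqnn (#|Y| - #|X|)) => n.
elim: n X => [|n IHn] X le_n iX leXY.
  exists X => //; split=> //; first exact: subsetUl.
  by apply/eqP; rewrite eqn_leq leXY -subn_eq0 -leqn0.
have [ltXY|geXY] := ltnP #|X| #|Y|; last first.
  exists X => //; split=> //; first exact: subsetUl.
  by apply/eqP; rewrite eqn_leq leXY.
have [y yYX iyX] := indep_aug iX iY ltXY.
move: yYX; rewrite inE => /andP[ynX yY].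
have cyX : #|y |: X| = #|X|.+1 by rewrite cardsU1 ynX.
have [||Z iZ [sXZ sZ cZ]] := IHn (y |: X) _ iyX.
- by rewrite cyX subnS; case: (#|Y| - #|X|) le_n.
- by rewrite cyX.
exists Z => //; split=> //; first exact: subset_trans (subsetUr _ _) sXZ.
apply: subset_trans sZ _; rewrite -setUA subUset subxx andbT.
by rewrite sub1set !inE yY orbT.
Qed.

Lemma basisP M B : reflect
  (B \in indep M /\ forall X, X \in indep M -> #|X| <= #|B|) (basis M B).
Proof.
apply: (iffP maxsetP) => [[iB maxB]|[iB maxB]]; split=> // X iX.
  rewrite leqNgt; apply/negP => /(indep_aug iB iX)[y].
  rewrite inE => /andP[ynB _] iyB.
  by have /eqP := maxB _ iyB (subsetUr _ _); rewrite eqEsubset subUset sub1set (negbTE ynB).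
move=> sBX; apply/esym/eqP; rewrite eqEcard sBX; exact: maxB.
Qed.

Lemma ex_basis M : exists B, basis M B.
Proof.
have [B maxB _] := @maxset_exists _ (fun X => X \in indep M) _ (indep0 M).
by exists B.
Qed.

Lemma basis_ground M B : basis M B -> B \subset ground M.
Proof. by case/basisP => /indep_ground. Qed.

(* The bases of the dual are the complements of the bases. *)
Definition dual_indep M : {set {set T}} :=
  [set X : {set T} | [exists B : {set T}, basis M B && (X \subset ground M :\: B)]].

Lemma dual_indepP M X : reflect
  (exists2 B, basis M B & X \subset ground M :\: B) (X \in dual_indep M).
Proof. by rewrite inE; apply: (iffP existsP) => [[B /andP[]]|[B bB sB]]; exists B; rewrite ?bB. Qed.

Fact dual_ground M X : X \in dual_indep M -> X \subset ground M.
Proof. by case/dual_indepP=> B _ /subset_trans; apply; apply: subsetDl. Qed.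

Fact dual_indep0 M : set0 \in dual_indep M.
Proof. by have [B bB] := ex_basis M; apply/dual_indepP; exists B; rewrite ?sub0set. Qed.

Fact dual_indep_sub M X Y :
  X \subset Y -> Y \in dual_indep M -> X \in dual_indep M.
Proof.
move=> sXY /dual_indepP[B bB sYB]; apply/dual_indepP.
by exists B => //; apply: subset_trans sYB.
Qed.

Fact dual_indep_aug M X Y :
    X \in dual_indep M -> Y \in dual_indep M -> #|X| < #|Y| ->
  exists2 y, y \in Y :\: X & y |: X \in dual_indep M.
Proof.
move=> /dual_indepP[B bB sXB] /dual_indepP[B' bB' sYB'] ltXY.
have [[iB maxB] [iB' maxB']] := (basisP _ _ bB, basisP _ _ bB').
have iB'X : B' :\: X \in indep M by apply: indep_sub iB'; apply: subsetDl.
have [Z iZ [sZ1 sZ2 cZ]] := indep_extend iB'X iB (maxB _ iB'X).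
have bZ : basis M Z by apply/basisP; split=> // W; rewrite cZ; apply: maxB.
have ZX : [disjoint X & Z].
  rewrite -setI_eq0; apply/eqP/setP=> x; rewrite !inE; apply/negP => /andP[xX xZ].
  have := subsetP sXB x xX; rewrite inE => /andP[xnB _].
  by have := subsetP sZ2 x xZ; rewrite !inE xX (negbTE xnB).
have [sYZ|/subsetPn[y yYX ynZ]] := boolP (Y :\: X \subset Z); last first.
  exists y => //; apply/dual_indepP; exists Z => //.
  rewrite subUset sub1set inE ynZ; move: (yYX); rewrite inE => /andP[_ yY].
  have -> /= := subsetP (subset_trans sYB' (subsetDl _ _)) y yY.
  by rewrite subsetD ZX andbT; apply: subset_trans sXB (subsetDl _ _).
exfalso.
have dYB' : [disjoint Y & B'] by move: sYB'; rewrite subsetD => /andP[].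
have dis : [disjoint B' :\: X & Y :\: X].
  rewrite disjoint_sym.
  apply: disjointWl (subsetDl _ _) _; exact: disjointWr (subsetDl _ _) dYB'.
have le1 : #|B' :\: X| + #|Y :\: X| <= #|B'|.
  apply: leq_trans (maxB' _ iZ).
  by have := subset_leq_card (introT (@subUsetP _ _ _ _) (conj sZ1 sYZ)); rewrite cardsU (disjoint_setI0 dis) cards0 subn0.
have le2 : #|B' :&: X| <= #|X :\: Y|.
  apply: subset_leq_card; apply/subsetP=> x; rewrite !inE => /andP[xB' ->].
  by rewrite andbT; apply/negP => xY; have := disjointFr dYB' xY; rewrite xB'.
have lt : #|X :\: Y| < #|Y :\: X|.
  by rewrite -(ltn_add2l #|X :&: Y|) cardsID setIC cardsID.
have := cardsID X B'; move: le1 le2 lt.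
move=> le1 le2 lt eqB; move: le1; rewrite -eqB addnC leq_add2r => le1.
by have := leq_trans lt (leq_trans le1 le2); rewrite ltnn.
Qed.

Definition dual M := Matroid (@dual_ground M) (@dual_indep0 M)
  (@dual_indep_sub M) (@dual_indep_aug M).

Definition delete_indep M X : {set {set T}} :=
  [set I in indep M | I \subset ground M :\: X].

Fact delete_ground M X I : I \in delete_indep M X -> I \subset ground M :\: X.
Proof. by rewrite inE => /andP[]. Qed.

Fact delete_indep0 M X : set0 \in delete_indep M X.
Proof. by rewrite inE indep0 sub0set. Qed.

Fact delete_indep_sub M X I J :
  I \subset J -> J \in delete_indep M X -> I \in delete_indep M X.
Proof.
by move=> sIJ; rewrite !inE => /andP[iJ sJ]; rewrite (indep_sub sIJ) ?(subset_trans sIJ).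
Qed.

Fact delete_indep_aug M X I J :
    I \in delete_indep M X -> J \in delete_indep M X -> #|I| < #|J| ->
  exists2 y, y \in J :\: I & y |: I \in delete_indep M X.
Proof.
rewrite !inE => /andP[iI sI] /andP[iJ sJ] ltIJ.
have [y yJI iyI] := indep_aug iI iJ ltIJ; exists y => //.
rewrite !inE iyI subUset sI sub1set andbT.
by apply: (subsetP sJ); move: yJI; rewrite inE => /andP[].
Qed.

Definition delete M X := Matroid (@delete_ground M X) (@delete_indep0 M X)
  (@delete_indep_sub M X) (@delete_indep_aug M X).

Definition contract M X := dual (delete (dual M) X).

Definition minor N M := exists X Y,
  [/\ X \subset ground M, Y \subset ground M, [disjoint X & Y]
    & eqmatroid N (contract (delete M X) Y)].

End Matroids.

(* The bijection is between the actual ground sets: a total map T -> T' need  *)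
(* not exist when T' is empty.                                                *)
Definition isomorphic (T T' : finType) (M : matroid T) (M' : matroid T') :=
  exists2 f : {x | x \in ground M} -> {y | y \in ground M'}, bijective f &
    forall X : {set {x | x \in ground M}},
      (val @: X \in indep M) = (val @: (f @: X) \in indep M').

Section Transversals.
Variables (T J : finType).
Implicit Types (A : J -> {set T}) (X Y S : {set T}).

(* A set system is an indexed family A, so repeated members are allowed. *)
Definition partial_transversal A X : bool :=
  [exists K : {set J}, exists x : {ffun {k | k \in K} -> T},
    [&& injectiveb x, [forall k, x k \in A (val k)] & X == x @: setT]].

Lemma partial_transversalP A X : reflect
  (exists f : T -> option J, {in X &, injective f} /\
     {in X, forall t, exists2 j, f t = Some j & t \in A j})
  (partial_transversal A X).
Proof.
apply: (iffP existsP) => [[K /existsP[x /and3P[/injectiveP injx /forallP xA /eqP->]]]|].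
  exists (fun t => omap val [pick k | x k == t]).
  have E k : [pick k' | x k' == x k] = Some k.
    by case: pickP => [k' /eqP/injx->|/(_ k)] //; rewrite eqxx.
  split=> [_ _ /imsetP[k _ ->] /imsetP[k' _ ->]|_ /imsetP[k _ ->]].
    by rewrite !E => -[/val_inj->].
  by exists (val k); rewrite ?E.
case=> f [injf fA].
pose K := [set j | [exists t in X, f t == Some j]].
have exK (k : {k | k \in K}) : exists t, (t \in X) && (f t == Some (val k)).
  by have := valP k; rewrite inE => /existsP.
pose x := [ffun k : {k | k \in K} => xchoose (exK k)].
have xP k : x k \in X /\ f (x k) = Some (val k).
  by rewrite ffunE; have /andP[? /eqP] := xchooseP (exK k).
exists K; apply/existsP; exists x; apply/and3P; split.
- apply/injectiveP=> k k' eqx; have [[_ e] [_ e']] := (xP k, xP k').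
  by apply: val_inj; move: e; rewrite eqx e' => -[].
- apply/forallP=> k; have [xX e] := xP k.
  by have [j] := fA _ xX; rewrite e => -[<-].
apply/eqP/setP=> t; apply/idP/imsetP=> [tX|[k _ ->]]; last by case: (xP k).
have [j fj _] := fA t tX.
have jK : j \in K by rewrite inE; apply/existsP; exists t; rewrite tX fj /=.
exists (exist _ j jK); rewrite ?inE //.
have [xX e] := xP (exist _ j jK).
by apply: injf => //; rewrite e fj.
Qed.

Definition presents A (M : matroid T) :=
  (forall j, A j \subset ground M) /\
  (forall X, (X \in indep M) = partial_transversal A X).

Definition ptrans A : {set {set T}} := [set X | partial_transversal A X].

Fact ptrans_ground S A (sAS : forall j, A j \subset S) X :
  X \in ptrans A -> X \subset S.
Proof.
rewrite inE => /partial_transversalP[f [_ fA]]; apply/subsetP=> t tX.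
by have [j _ /(subsetP (sAS j))] := fA t tX.
Qed.

Fact ptrans0 A : set0 \in ptrans A.
Proof.
rewrite inE; apply/partial_transversalP; exists (fun=> None).
by split=> [t t'|t]; rewrite inE.
Qed.

Fact ptrans_sub A X Y : X \subset Y -> Y \in ptrans A -> X \in ptrans A.
Proof.
move=> /subsetP sXY; rewrite !inE => /partial_transversalP[f [injf fA]].
apply/partial_transversalP; exists f.
by split=> [t t' /sXY tY /sXY|t /sXY]; [apply: injf | apply: fA].
Qed.

(* Take a matching of X agreeing as much as possible with one of Y. *)
Fact ptrans_aug A X Y : X \in ptrans A -> Y \in ptrans A -> #|X| < #|Y| ->
  exists2 y, y \in Y :\: X & y |: X \in ptrans A.
Proof.
rewrite !inE => /partial_transversalP[f [injf fA]].
move=> /partial_transversalP[g [injg gA]] ltXY.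
have [n] := ubnP #|[set t in X | f t != g t]|.
elim: n f injf fA => // n IHn f injf fA; rewrite ltnS => le_n.
have /subsetPn[_ /imsetP[y yY ->] gyX] : ~~ (g @: Y \subset f @: X).
  by apply/negP=> /subset_leq_card; rewrite !card_in_imset // leqNgt ltXY.
pose f' t := if t == y then g y else f t.
have f'X t : t \in X -> f' t = g y -> t = y.
  rewrite /f'; case: eqP => // _ tX eqf; case/negP: gyX.
  by rewrite -eqf imset_f.
have injf' : {in y |: X &, injective f'}.
  move=> t t'; rewrite !inE /f'.
  case: (eqVneq t y) => [-> _|nty /= tX]; case: (eqVneq t' y) => [-> _|nt'y /= t'X] //.
  - by move=> e; case/negP: gyX; rewrite e imset_f.
  - by move=> e; case/negP: gyX; rewrite -e imset_f.
  - exact: injf.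
have f'A : {in y |: X, forall t, exists2 j, f' t = Some j & t \in A j}.
  move=> t; rewrite !inE /f'; case: (eqVneq t y) => [-> _|_ /= /fA //]; exact: gA.
have [yX|ynX] := boolP (y \in X); last first.
  by exists y; [rewrite inE ynX | rewrite inE; apply/partial_transversalP; exists f'].
have eyX : y |: X = X by apply/setUidPr; rewrite sub1set.
rewrite eyX in injf' f'A.
apply: (IHn f') => //; apply: leq_trans le_n; apply: proper_card.
apply/properP; split.
  by apply/subsetP=> t; rewrite !inE /f'; case: (eqVneq t y) => [->|//]; rewrite eqxx andbF.
exists y; rewrite !inE yX /f' ?eqxx //=.
by apply: contraNneq gyX => <-; rewrite imset_f.
Qed.

Definition transversal_matroid S A (sAS : forall j, A j \subset S) :=
  Matroid (@ptrans_ground S A sAS) (@ptrans0 A) (@ptrans_sub A) (@ptrans_aug A).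

Lemma presents_transversal_matroid S A (sAS : forall j, A j \subset S) :
  presents A (transversal_matroid sAS).
Proof. by split=> // X; rewrite inE. Qed.

Definition antichain A := forall i j, i != j -> ~~ (A i \subset A j).

End Transversals.

Section MultiPath.
Variable T : finType.
Implicit Types (S I : {set T}) (sigma : {perm T}).

(* A permutation of S is a permutation of T fixing the complement of S; it is *)
(* cyclic when S is a single cycle (the identity if #|S| <= 1).               *)
Definition cyclic_perm_of S sigma :=
  perm_on S sigma /\ {in S &, forall x y, y \in porbit sigma x}.

(* The elements f, sigma f, sigma^2 f, ... up to the first occurrence of l. *)
Definition sigma_seg sigma (f l : T) : {set T} :=
  [set x in traject sigma f (findex sigma f l).+1].

Definition sigma_interval S sigma I := exists f l : T,
  [/\ f \in S, l \in S & I = sigma_seg sigma f l].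

Definition multi_path (M : matroid T) :=
  exists (sigma : {perm T}) (J : finType) (A : J -> {set T}),
    [/\ cyclic_perm_of (ground M) sigma,
        forall j, sigma_interval (ground M) sigma (A j),
        antichain A & presents A M].

End MultiPath.

Section LatticePaths.
Variables m r : nat.

(* A path is its sequence of steps: true is North, false is East. *)
Definition lattice_path (p : (m + r).-tuple bool) :=
  (count negb p == m) && (count id p == r).

Definition height (p : seq bool) k := count id (take k p).

(* The k-th points of p and q lie on the same line x + y = k, so p never goes *)
(* above q iff its k-th point is never higher than that of q.                 *)
Definition never_above (p q : (m + r).-tuple bool) :=
  [forall k : 'I_(m + r).+1, height p k <= height q k].

(* Steps and North steps are numbered from 0: step k is the i-th North step   *)
(* iff it is North and follows exactly i North steps.                         *)
Definition north_step (p : (m + r).-tuple bool) (k : 'I_(m + r)) (i : 'I_r) :=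
  tnth p k && (height p k == i).

Definition north_set (P Q : (m + r).-tuple bool) (i : 'I_r) : {set 'I_(m + r)} :=
  [set k | [exists p : (m + r).-tuple bool,
     [&& lattice_path p, never_above P p, never_above p Q & north_step p k i]]].

Definition lpm (P Q : (m + r).-tuple bool) : matroid 'I_(m + r) :=
  transversal_matroid (fun i => subsetT (north_set P Q i)).

End LatticePaths.

Definition lattice_path_matroid (T : finType) (M : matroid T) :=
  exists m r (P Q : (m + r).-tuple bool),
    [/\ lattice_path P, lattice_path Q, never_above P Q
      & isomorphic M (lpm P Q)].

(* Main.v *)
(** List the ground set as [s] in cyclic order and view a set [B] of size [r] as the
    lattice path whose [x]-th step is North when the [x]-th element of [s] is in [B],
    started at some height [c] and continued periodically.  For an antichain of [r]
    cyclic intervals, [B] is a transversal iff for some [c] its path stays between the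
    path of the last elements and the path of the first elements, so the bases of a
    multi-path matroid are the [r]-sets having a path that satisfies given height
    bounds.  Conversely, any system of height bounds satisfied by some path yields a
    multi-path matroid: the pointwise maximum [F] of the admissible paths is again an
    admissible path; a path raised until it touches [F] lags behind [F] by at most
    [n - r] positions; and the pointwise minimum [L] of the admissible paths with that
    small lag, together with [F], gives the last and first elements of the intervals,
    the small lag being what makes them an antichain.  In terms of height bounds
    duality is a reflection, deletion discards steps, and lattice path matroids are
    the case where the starting height is fixed.  The 3-whirl separates the classes. *)

Require Import Defs.
From mathcomp Require Import all_boot all_order all_fingroup.
From mathcomp Require Import ssralg ssrnum ssrint zify.

Set Implicit Arguments.
Unset Strict Implicit.
Unset Printing Implicit Defensive.

(** * Bases of duals and deletions *)

Section Bases.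
Variable T : finType.
Implicit Types (M : matroid T) (B C X Y : {set T}).

Lemma basis_card M B B' : basis M B -> basis M B' -> #|B| = #|B'|.
Proof.
move=> /basisP[iB mB] /basisP[iB' mB'].
by apply/eqP; rewrite eqn_leq mB' // mB.
Qed.

Lemma indep_basisP M X : reflect (exists2 B, basis M B & X \subset B) (X \in indep M).
Proof.
apply: (iffP idP) => [iX|[B /basisP[iB _] sXB]]; last exact: indep_sub iB.
have [B /basisP[iB mB]] := ex_basis M.
have [Z iZ [sXZ _ cZ]] := indep_extend iX iB (mB _ iX).
by exists Z => //; apply/basisP; split=> // Y iY; rewrite cZ mB.
Qed.

Lemma eq_basis_indep M N : (forall B, basis M B <-> basis N B) -> indep M = indep N.
Proof.
move=> eqB; apply/setP=> X.
by apply/indep_basisP/indep_basisP => -[B bB sXB]; exists B => //; apply/eqB.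
Qed.

Lemma basis_indep_card M B0 B : basis M B0 ->
  (basis M B <-> B \in indep M /\ #|B| = #|B0|).
Proof.
move=> bB0; have [_ mB0] := basisP _ _ bB0.
split=> [bB|[iB cB]]; last by apply/basisP; split=> // X iX; rewrite cB mB0.
by case: (basisP _ _ bB) => iB _; rewrite iB (basis_card bB bB0).
Qed.

Lemma basis_dual M C :
  basis (dual M) C <-> C \subset ground M /\ basis M (ground M :\: C).
Proof.
have DD B : B \subset ground M -> ground M :\: (ground M :\: B) = B.
  by move=> sB; rewrite setDDr setDv set0U; apply/setIidPr.
have bD B : basis M B -> basis (dual M) (ground M :\: B).
  move=> bB; have sB := basis_ground bB.
  apply/basisP; split=> [|X /dual_indepP[B' bB' /subset_leq_card]].
    by apply/dual_indepP; exists B.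
  have sB' := basis_ground bB'.
  by rewrite !cardsD !(setIidPr _) // (basis_card bB bB').
split=> [bC|[sC bC]]; last by rewrite -(DD C sC); apply: bD.
have [/dual_indepP[B bB sCB] _] := basisP _ _ bC.
suff -> : C = ground M :\: B.
  by rewrite subsetDl DD // basis_ground.
by apply/eqP; rewrite eqEcard sCB (basis_card bC (bD _ bB)) leqnn.
Qed.

(** Take a basis [B1] of [M] containing [B0] and let [Z] be the rest of [B1]. Any basis [B] of the
    deletion extends inside [B :|: B1] to a basis of [M]. What is added lies in [Y] because [B] is
    maximal, hence in [Z], and by cardinality it is all of [Z]. *)
Lemma basis_delete M Y : exists B0 Z : {set T}, [/\ basis (delete M Y) B0, Z \subset Y &
  forall B, basis (delete M Y) B <->
    [/\ B \subset ground M :\: Y, #|B| = #|B0| & basis M (B :|: Z)]].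
Proof.
have [B0 bB0] := ex_basis (delete M Y).
have [iB0 mB0] := basisP _ _ bB0.
move: (iB0); rewrite inE => /andP[iMB0 sB0].
have /indep_basisP[B1 bB1 sB01] := iMB0.
have [iB1 mB1] := basisP _ _ bB1.
have inY (B Z : {set T}) x : basis (delete M Y) B -> Z \in indep M -> B \subset Z ->
    x \in Z -> x \notin B -> x \in Y.
  move=> /basisP[iB mB] iZ sBZ xZ xB; apply: contraT => xY.
  have : x |: B \in indep (delete M Y).
    rewrite inE (indep_sub _ iZ) ?subUset ?sub1set ?xZ //=.
    by rewrite inE xY (subsetP (indep_ground iZ)) //=; move: iB; rewrite inE => /andP[].
  by move/mB; rewrite cardsU1 xB ltnn.
exists B0, (B1 :\: B0); split=> //.
  by apply/subsetP=> x; rewrite inE => /andP[xB0 xB1]; apply: inY bB0 iB1 sB01 xB1 xB0.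
move=> B; split=> [bB|[sB cB bBZ]]; last first.
  apply/(basis_indep_card _ bB0); split=> //; rewrite inE sB andbT.
  by apply/indep_basisP; exists (B :|: (B1 :\: B0)) => //; apply: subsetUl.
have cB := basis_card bB bB0.
have [iB mB] := basisP _ _ bB.
move: (iB); rewrite inE => /andP[iMB sB].
split=> //.
have [Z iZ [sBZ sZ cZ]] := indep_extend iMB iB1 (mB1 _ iMB).
have sZ' : Z \subset B :|: (B1 :\: B0).
  apply/subsetP=> x xZ; have := subsetP sZ x xZ; rewrite !inE.
  case: (boolP (x \in B)) => //= xB xB1; rewrite xB1 andbT.
  apply: contraL (inY _ _ _ bB iZ sBZ xZ xB) => /(subsetP sB0).
  by rewrite inE => /andP[].
suff <- : Z = B :|: (B1 :\: B0).
  by apply/(basis_indep_card _ bB1).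
apply/eqP; rewrite eqEcard sZ' cZ (leq_trans (leq_card_setU _ _)) //.
by rewrite cB cardsD (setIidPr sB01) subnKC // subset_leq_card.
Qed.

End Bases.

(** * Height bounds *)

Section Level.
Variable T : finType.
Implicit Types (s : seq T) (B C S Y : {set T}).

Definition level s B x := count [in B] (take x s).

Lemma level0 s B : level s B 0 = 0.
Proof. by rewrite /level take0. Qed.

Lemma level_size s B : uniq s -> B \subset s -> level s B (size s) = #|B|.
Proof.
move=> us sBs; rewrite /level take_size -size_filter -(card_uniqP _) ?filter_uniq //.
apply: eq_card => x; rewrite mem_filter /=; apply/andP/idP => [[]//|xB].
by split=> //; apply: (subsetP sBs).
Qed.

Lemma levelS s B x x0 : x < size s -> level s B x.+1 = level s B x + (nth x0 s x \in B).
Proof. by move=> ltx; rewrite /level (take_nth x0) // -cats1 count_cat /= addn0. Qed.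

Lemma level_step s B x : level s B x <= level s B x.+1 <= (level s B x).+1.
Proof.
have [ltx|gex] := ltnP x (size s); last by rewrite /level !take_oversize ?leqnn //=; lia.
case: s ltx => // x0 s ltx; rewrite (levelS _ x0) //; by case: (_ \in B); lia.
Qed.

Lemma level_leq s B x : level s B x <= x.
Proof. by rewrite (leq_trans (count_size _ _)) // size_take; case: ltnP => //; lia. Qed.

Lemma level_le s B x y : x <= y -> level s B x <= level s B y.
Proof.
elim: y => [|y IHy]; first by rewrite leqn0 => /eqP->.
by rewrite leq_eqVlt ltnS => /orP[/eqP->//|/IHy]; have := level_step s B y; lia.
Qed.

Lemma level_sub s B C x : B \subset C -> level s B x <= level s C x.
Proof. by move=> sBC; apply: sub_count => y /(subsetP sBC). Qed.

Lemma levelU s B C x : [disjoint B & C] -> level s (B :|: C) x = level s B x + level s C x.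
Proof.
move=> dBC; rewrite /level -(count_predUI [in B]).
rewrite [X in _ + X](eq_count (a2 := pred0)) ?count_pred0 ?addn0; last first.
  by move=> y /=; case: (boolP (y \in B)) => //= yB; rewrite (disjointFr dBC).
by apply: eq_count => y /=; rewrite inE.
Qed.

Lemma levelD s S B x : S =i s -> x <= size s ->
  level s (S :\: B) x + level s B x = x.
Proof.
move=> eqS lex; rewrite -[RHS](size_takel lex) -(count_predC [in B]) addnC; congr (_ + _).
by apply: eq_in_count => y ys /=; rewrite inE eqS (mem_take ys) andbT.
Qed.

(** Discarding the steps in [Y] moves abscissa [x] to the number of steps kept among the first [x];
    a set disjoint from [Y] loses no North step. *)
Lemma level_filter s Y B x : [disjoint B & Y] ->
  level [seq y <- s | y \notin Y] B (count [predC Y] (take x s)) = level s B x.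
Proof.
move=> dBY; rewrite /level.
have -> : take (count [predC Y] (take x s)) [seq y <- s | y \notin Y] =
    [seq y <- take x s | y \notin Y].
  by rewrite -{2}(cat_take_drop x s) filter_cat take_size_cat // size_filter.
rewrite count_filter; apply: eq_count => y /=.
by case: (boolP (y \in B)) => //= yB; rewrite (disjointFr dBY).
Qed.

End Level.

(* [s] lists the ground set in cyclic order; the bases are the sets whose path,
   started at a suitable height [c], satisfies finitely many height bounds. The
   bound number [z] is imposed at the abscissa [pos z], so that several bounds may
   bear on the same abscissa. *)
Definition banded (T : finType) (M : matroid T) :=
  exists (s : seq T) (r N : nat) (pos : nat -> nat) (lo hi : nat -> int),
  [/\ uniq s, ground M =i s, 0 < N, forall z, z < N -> pos z <= size s &
      forall B : {set T}, basis M B <-> [/\ B \subset ground M, #|B| = r &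
        exists c : int, forall z, z < N ->
          (lo z <= c + (level s B (pos z))%:Z <= hi z)%R]].

Section Banded.
Variable T : finType.
Implicit Types (M N : matroid T) (B X Y : {set T}).

Lemma card_uniq_ground (s : seq T) (S : {set T}) : uniq s -> S =i s -> #|S| = size s.
Proof. by move=> us eqS; rewrite (eq_card eqS); apply/card_uniqP. Qed.

Lemma banded_eqmatroid M N : eqmatroid M N -> banded N -> banded M.
Proof.
by case: M N => [g i ? ? ? ?] [g' i' ? ? ? ?] [/= eg ei] [s [r [K [pos [lo [hi H]]]]]];
  subst g' i'; exists s, r, K, pos, lo, hi.
Qed.

(** Complementing a basis exchanges North and East steps, so a height [h] at abscissa [x] becomes
    [x - h]: the two bounds trade places and the starting height changes sign. *)
Lemma banded_dual M : banded M -> banded (dual M).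
Proof.
move=> [s [r [N [pos [lo [hi [us eqS N0 lepos bas]]]]]]].
exists s, (size s - r), N, pos, (fun z => (pos z)%:Z - hi z)%R,
  (fun z => (pos z)%:Z - lo z)%R; split=> // C.
have cS := card_uniq_ground us eqS.
have [B0 /[dup] bB0 /bas[sB0 cB0 _]] := ex_basis M.
have := subset_leq_card sB0; rewrite cB0 cS => ler.
rewrite basis_dual bas subsetDl /=.
split=> [[sC [_ cC [c Hc]]]|[sC cC [c Hc]]].
  have := subset_leq_card sC; move: cC; rewrite cardsD (setIidPr sC) cS => cC lC.
  split=> //; first lia.
  exists (- c)%R => z lz; have := Hc z lz; have := levelD C eqS (lepos z lz); lia.
split=> //; split=> //; first by rewrite cardsD (setIidPr sC) cS; lia.
exists (- c)%R => z lz; have := Hc z lz; have := levelD C eqS (lepos z lz); lia.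
Qed.

(** By [basis_delete], one fixed [Z] completes every basis of the deletion, so its contribution to
    the height can be moved into the bounds. Distinct abscissas may collapse into one when steps are
    discarded, while their bounds are all kept. *)
Lemma banded_delete M Y : banded M -> banded (delete M Y).
Proof.
move=> [s [r [N [pos [lo [hi [us eqS N0 lepos bas]]]]]]].
have [B0 [Z [bB0 sZY basD]]] := basis_delete M Y.
have [_ _ /bas[sB0Z cB0Z _]] := (basD B0).1 bB0.
have dis B : B \subset ground M :\: Y -> [disjoint B & Y].
  by rewrite subsetD => /andP[].
exists [seq y <- s | y \notin Y], #|B0|, N,
  (fun z => count [predC Y] (take (pos z) s)),
  (fun z => lo z - (level s Z (pos z))%:Z)%R,
  (fun z => hi z - (level s Z (pos z))%:Z)%R.
split=> //; first exact: filter_uniq.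
- by move=> y; rewrite mem_filter inE eqS.
- move=> z _; rewrite size_filter -{2}(cat_take_drop (pos z) s) count_cat.
  exact: leq_addr.
move=> B; rewrite basD /=; split=> [[sB cB /bas[sBZ cBZ [c Hc]]]|[sB cB [c Hc]]].
  split=> //; exists c => z lz; have := Hc z lz.
  by rewrite levelU ?(disjointWr sZY) ?dis // level_filter ?dis //; lia.
split=> //; apply/bas; split.
- rewrite subUset (subset_trans sB (subsetDl _ _)) /=.
  by apply: subset_trans sB0Z; apply: subsetUr.
- move: cB0Z; rewrite !cardsU !disjoint_setI0 ?cards0 ?cB //.
    exact: disjointWr sZY (dis _ sB).
  by case/basisP: bB0 => /indep_ground/dis/(disjointWr sZY).
exists c => z lz; have := Hc z lz.
by rewrite levelU ?(disjointWr sZY) ?dis // level_filter ?dis //; lia.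
Qed.

Lemma banded_minor M N : banded M -> minor N M -> banded N.
Proof.
move=> bM [X [Y [_ _ _ /banded_eqmatroid]]]; apply.
by do 2!apply/banded_dual/banded_delete.
Qed.

End Banded.

(** * Transversals of antichains of cyclic intervals *)

Lemma card_set_sum (J : finType) (P : pred J) : #|[set j | P j]| = \sum_j P j.
Proof.
rewrite cardsE -sum1_card big_mkcond; apply: eq_bigr => j _.
by rewrite unfold_in; case: (P j).
Qed.

Lemma level_card (T : finType) (s : seq T) (B : {set T}) x : uniq s -> B \subset s ->
  level s B x = #|[set t in B | index t s < x]|.
Proof.
move=> us sBs; rewrite /level -size_filter -(card_uniqP _); last first.
  by rewrite filter_uniq ?take_uniq.
apply: eq_card => t; rewrite mem_filter inE /=.
by case: (boolP (t \in B)) => //= /(subsetP sBs); apply: in_take.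
Qed.

(* Membership in the cyclic interval of positions from [f] to [l]. *)
Definition cyc f l p := (f <= p <= l) || (l < f) && ((p <= l) || (f <= p)).

Section CyclicIntervals.
Variables (T J : finType) (s : seq T) (f l : J -> nat) (A : J -> {set T}).
Implicit Type B : {set T}.
Hypotheses (us : uniq s) (ltf : forall j, f j < size s) (ltl : forall j, l j < size s).
Hypothesis memA : forall j t, (t \in A j) = (t \in s) && cyc (f j) (l j) (index t s).

Lemma cyc_antichainP : antichain A <-> forall i j, i != j ->
  exists p, [/\ p < size s, cyc (f i) (l i) p & ~~ cyc (f j) (l j) p].
Proof.
split=> antiA i j /antiA => [/subsetPn[t]|[p [ltp ip jp]]].
  rewrite !memA => /andP[ts it]; rewrite ts /= => jt.
  by exists (index t s); rewrite index_mem.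
have [t0 _] : exists t0 : T, true by case: (s) ltp => // t0; exists t0.
apply/subsetPn; exists (nth t0 s p).
  by rewrite memA mem_nth // index_uniq.
by rewrite memA mem_nth // index_uniq.
Qed.

Hypothesis antiA : antichain A.

(** The intervals counted here contain both ends of the list. They are already open at abscissa 0,
    so the upper path starts at this height. *)
Let wrap := #|[set j | l j < f j]|.

Lemma cyc_first_inj : injective f.
Proof.
move=> i j eqf; apply/eqP; apply: contraT => neq.
have neq' : j != i by rewrite eq_sym.
have [p [_ pi pj]] := cyc_antichainP.1 antiA i j neq.
have [q [_ qj qi]] := cyc_antichainP.1 antiA j i neq'.
have := ltl i; have := ltl j.
by move: pi pj qi qj; rewrite /cyc; lia.
Qed.

Lemma cyc_last_inj : injective l.
Proof.
move=> i j eql; apply/eqP; apply: contraT => neq.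
have neq' : j != i by rewrite eq_sym.
have [p [? pi pj]] := cyc_antichainP.1 antiA i j neq.
have [q [? qj qi]] := cyc_antichainP.1 antiA j i neq'.
by move: pi pj qi qj; rewrite /cyc; lia.
Qed.

(** Intervals are indexed by the order of their last elements, so that a North step at height [h]
    can be assigned the interval of rank [h] modulo [#|J|]. *)
Let rank_of j := #|[set i | l i < l j]|.

Lemma rank_last_lt j : rank_of j < #|J|.
Proof.
rewrite /rank_of -cardsT; apply: proper_card; apply/properP; split.
  by apply/subsetP => i _; rewrite inE.
by exists j; rewrite !inE ?ltnn.
Qed.

Lemma rank_last_inj : injective rank_of.
Proof.
suff lt i j : l i < l j -> rank_of i < rank_of j.
  move=> i j eqr; apply: cyc_last_inj; case: (ltngtP (l i) (l j)) => // /lt.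
    by rewrite eqr ltnn.
  by rewrite eqr ltnn.
move=> ltij; apply: proper_card; apply/properP; split.
  by apply/subsetP=> k; rewrite !inE => /ltn_trans; apply.
by exists i; rewrite !inE ?ltnn.
Qed.

(** The inequality holds for each [i] separately: if [A i] crosses the cut or begins before [A j],
    then it ends before [A j] does, as otherwise it would contain [A j]. *)
Lemma first_rank_nowrap j : f j <= l j -> wrap + #|[set i | f i < f j]| <= rank_of j.
Proof.
move=> lefl; rewrite /wrap /rank_of !card_set_sum -big_split.
apply: leq_sum => i _ /=; have [->|neq] := eqVneq i j; first lia.
have neq' : j != i by rewrite eq_sym.
have [p [? pj pi]] := cyc_antichainP.1 antiA j i neq'.
by have := ltl i; move: pj pi; rewrite /cyc; lia.
Qed.

(** The same comparison for an interval that crosses the cut, whose first element belongs to the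
    height one period above its rank. *)
Lemma first_rank_wrap j : l j < f j ->
  wrap + #|[set i | f i < f j]| <= rank_of j + #|J|.
Proof.
(* Writing [#|J|] as a sum of ones keeps the comparison termwise. *)
move=> ltlf; rewrite -cardsT -(_ : [set i | xpredT i] = setT :> {set J}); last first.
  by apply/setP=> i; rewrite !inE.
rewrite /wrap /rank_of !card_set_sum -!big_split.
apply: leq_sum => i _ /=; have [->|neq] := eqVneq i j; first lia.
have neq' : j != i by rewrite eq_sym.
have [p [? pj pi]] := cyc_antichainP.1 antiA j i neq'.
by have := ltl i; move: pj pi; rewrite /cyc; lia.
Qed.

(** Match each [t] in [B] with the interval whose rank is the height of its North step modulo
    [#|J|]. These heights are distinct and span fewer than [#|J|] units, so the matching is
    injective. The lower bound keeps [t] from coming after the last element of its interval, the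
    upper bound from coming before the first. *)
Lemma cyc_level_transversal B c : B \subset s -> #|B| = #|J| ->
    (forall x, x <= size s ->
      #|[set j | l j < x]| <= c + level s B x <= wrap + #|[set j | f j < x]|) ->
  partial_transversal A B.
Proof.
move=> sBs cB Hc.
have lev t : t \in B -> level s B (index t s).+1 = (level s B (index t s)).+1.
  move=> tB; have ts := subsetP sBs t tB.
  by rewrite (levelS _ t) ?index_mem // nth_index // tB addn1.
have levlt t : t \in B -> level s B (index t s) < #|J|.
  move=> tB; rewrite -lev // -cB -(level_size us sBs).
  by apply: level_le; rewrite index_mem (subsetP sBs).
have levinj t t' : t \in B -> t' \in B ->
    level s B (index t s) = level s B (index t' s) -> t = t'.
  move=> tB t'B; have := lev t tB; have := lev t' t'B.
  have := level_le s B (x := (index t s).+1) (y := index t' s).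
  have := level_le s B (x := (index t' s).+1) (y := index t s).
  case: (ltngtP (index t s) (index t' s)) => [||e _ _ _ _ _]; try lia.
  by rewrite -(nth_index t (subsetP sBs t tB)) e nth_index // (subsetP sBs).
have ler : c <= #|J|.
  have e0 : #|[set j | f j < 0]| = 0 by apply: eq_card0 => j; rewrite inE.
  have := Hc 0 (leq0n _); rewrite level0 e0.
  have := max_card [set j | l j < f j]; rewrite -/wrap; lia.
have onto h : h < #|J| -> exists j, rank_of j = h.
  move=> lth; pose g j := Ordinal (rank_last_lt j).
  have injg : injective g by move=> i j [] /rank_last_inj.
  have /imsetP[j _ [->]] : Ordinal lth \in g @: setT.
    rewrite (_ : g @: setT = setT) ?inE //; apply/eqP.
    by rewrite eqEcard subsetT card_imset // !cardsT card_ord leqnn.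
  by exists j.
(* As [c] is at most [#|J|] and the level is below it, a single subtraction reduces the height
   modulo [#|J|]. *)
pose h t := if level s B (index t s) + c < #|J| then level s B (index t s) + c
            else level s B (index t s) + c - #|J|.
apply/partial_transversalP; exists (fun t => [pick j | rank_of j == h t]).
have pickh t : t \in B -> exists2 j, [pick j | rank_of j == h t] = Some j & rank_of j = h t.
  move=> tB; have [|j ej] := onto (h t).
    by have := levlt t tB; rewrite /h; case: ifP; lia.
  by case: pickP => [i /eqP|/(_ j)]; [exists i | rewrite ej eqxx].
split=> [t t' tB t'B|t tB].
  have [j -> ej] := pickh t tB; have [j' -> ej'] := pickh t' t'B.
  case=> ejj; move: ej; rewrite ejj ej' => eh; apply: levinj => //.
  have := levlt t tB; have := levlt t' t'B; move: eh; rewrite /h.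
  by case: ifP; case: ifP; lia.
have [j -> ej] := pickh t tB; exists j => //.
have ts := subsetP sBs t tB; rewrite memA ts /=.
have ltp : index t s < size s by rewrite index_mem.
set p := index t s in ltp *.
have /andP[Lp _] := Hc p (ltnW ltp).
have /andP[_ Fp] := Hc p.+1 ltp; rewrite lev // -/p in Fp.
have lep : level s B p + c = rank_of j -> p <= l j.
  move=> eh; rewrite leqNgt; apply/negP => ltlp.
  suff : rank_of j < #|[set j | l j < p]| by lia.
  apply: proper_card; apply/properP; split.
    by apply/subsetP=> i; rewrite !inE; lia.
  by exists j; rewrite !inE ?ltnn.
have gep : wrap + #|[set i | f i < f j]| <= level s B p + c -> f j <= p.
  move=> le; rewrite leqNgt; apply/negP => ltpf.
  suff : #|[set i | f i < p.+1]| <= #|[set i | f i < f j]| by lia.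
  by apply: subset_leq_card; apply/subsetP => i; rewrite !inE; lia.
have leJ := max_card [set i | f i < p.+1].
have := levlt t tB; have := rank_last_lt j.
(* If [A j] does not cross the cut, a reduced height would be [rank_of j + #|J|], which the upper
   bound forbids since [wrap <= rank_of j]. If it crosses, an unreduced height gives [p <= l j] and
   a reduced one [f j <= p], and either suffices. *)
rewrite /cyc; case: (leqP (f j) (l j)) => [lefl|ltlf];
  have := first_rank_nowrap; have := first_rank_wrap.
  move=> _ /(_ j lefl); move: ej; rewrite /h -/p; case: ifP; lia.
move=> /(_ j ltlf) + _; move: ej; rewrite /h -/p; case: ifP; lia.
Qed.

(** Start the path at the number of intervals whose chosen element comes after their last element in
    the list, which happens only to intervals crossing the cut. Both bounds then hold interval by
    interval. *)
Lemma cyc_transversal_level B : #|B| = #|J| -> partial_transversal A B ->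
  B \subset s /\ exists c, forall x, x <= size s ->
      #|[set j | l j < x]| <= c + level s B x <= wrap + #|[set j | f j < x]|.
Proof.
move=> cB /partial_transversalP[g [injg gA]].
have sBs : B \subset s.
  by apply/subsetP=> t /gA[j _]; rewrite memA => /andP[].
split=> //.
have [b bP] : exists b : J -> T, forall j, b j \in B /\ g (b j) = Some j.
  apply: (fin_all_exists (P := fun j t => t \in B /\ g t = Some j)) => j.
  have /imsetP[t tB ->] : Some j \in g @: B; last by exists t.
  have -> : g @: B = Some @: [set: J].
    apply/eqP; rewrite eqEcard; apply/andP; split.
      by apply/subsetP=> _ /imsetP[t /gA[i -> _] ->]; rewrite imset_f.
    by rewrite (card_in_imset injg) cB card_imset ?cardsT // => ? ? [].
  by rewrite imset_f.
have injb : injective b.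
  by move=> i j eqb; have := (bP i).2; rewrite eqb (bP j).2 => -[].
have imb : b @: setT = B.
  apply/eqP; rewrite eqEcard card_imset // cardsT cB leqnn andbT.
  by apply/subsetP=> _ /imsetP[j _ ->]; case: (bP j).
have lev x : level s B x = #|[set j | index (b j) s < x]|.
  rewrite level_card // -(card_imset _ injb); apply: eq_card => t.
  rewrite !inE; apply/andP/imsetP => [[]|[j]].
    by rewrite -imb => /imsetP[j _ ->] ltx; exists j; rewrite ?inE.
  by rewrite inE => ltx ->; split; case: (bP j).
exists #|[set j | l j < index (b j) s]| => x lex.
have bA j : cyc (f j) (l j) (index (b j) s).
  have [bB gb] := bP j; have [i] := gA _ bB.
  by rewrite gb => -[<-]; rewrite memA => /andP[].
rewrite lev /wrap !card_set_sum -!big_split; apply/andP; split; apply: leq_sum => j _ /=;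
  by have := bA j; rewrite /cyc; lia.
Qed.

Lemma cyc_transversalP B : #|B| = #|J| -> (partial_transversal A B <->
  B \subset s /\ exists c, forall x, x <= size s ->
      #|[set j | l j < x]| <= c + level s B x <= wrap + #|[set j | f j < x]|).
Proof.
move=> cB; split=> [|[sBs [c]]]; first exact: cyc_transversal_level.
exact: cyc_level_transversal.
Qed.

(** The first elements of the intervals are distinct. This makes the bases exactly the transversals
    with [#|J|] elements. *)
Lemma cyc_full_transversal : exists2 B : {set T}, #|B| = #|J| & partial_transversal A B.
Proof.
have [J0|] := posnP #|J|.
  by exists set0; [rewrite cards0 J0 | have := ptrans0 A; rewrite inE].
case/card_gt0P=> j0 _.
have [t0 _] : exists t0 : T, true by have := ltf j0; case: (s) => // t0; exists t0.
pose b j := nth t0 s (f j).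
have injb : injective b.
  move=> i j /eqP; rewrite nth_uniq // => /eqP; exact: cyc_first_inj.
exists (b @: setT); first by rewrite card_imset ?cardsT.
apply/partial_transversalP; exists (fun t => [pick j | b j == t]).
have E j : [pick i | b i == b j] = Some j.
  by case: pickP => [i /eqP/injb->|/(_ j)] //; rewrite eqxx.
split=> [_ _ /imsetP[i _ ->] /imsetP[j _ ->]|_ /imsetP[j _ ->]].
  by rewrite !E => -[->].
exists j; first exact: E.
rewrite memA mem_nth ?index_uniq //=.
by rewrite /cyc; lia.
Qed.

Lemma partial_transversal_card B : partial_transversal A B -> #|B| <= #|J|.
Proof.
move=> /partial_transversalP[g [injg gA]].
rewrite -(card_in_imset injg) -cardsT -(card_imset setT (f := Some)) => [|? ? []] //.
apply: subset_leq_card; apply/subsetP => _ /imsetP[t /gA[j -> _] ->].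
by rewrite imset_f.
Qed.

Lemma cyc_presents_basis (M : matroid T) B : presents A M ->
  (basis M B <-> #|B| = #|J| /\ partial_transversal A B).
Proof.
move=> [_ iM]; have [B0 cB0 tB0] := cyc_full_transversal.
have bB0 : basis M B0.
  apply/basisP; split=> [|X]; first by rewrite iM.
  by rewrite iM cB0; apply: partial_transversal_card.
rewrite (basis_indep_card _ bB0) iM cB0; tauto.
Qed.

End CyclicIntervals.

(** * Cyclic permutations read as lists *)

Section CyclicOrder.
Variables (T : finType) (s : seq T) (t0 : T) (sigma : {perm T}).
Hypotheses (us : uniq s)
  (sigma_nth : forall i, i.+1 < size s -> sigma (nth t0 s i) = nth t0 s i.+1)
  (sigma_last : sigma (nth t0 s (size s).-1) = nth t0 s 0).

Lemma iter_sigma_nth a d : a < size s -> d <= size s ->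
  iter d sigma (nth t0 s a) =
  nth t0 s (if a + d < size s then a + d else a + d - size s).
Proof.
move=> lta; elim: d => [|d IHd] led; first by rewrite addn0 lta.
rewrite iterS IHd; last exact: ltnW.
case: (ltnP (a + d) (size s)) => [lt1|ge1].
  case: (ltnP (a + d.+1) (size s)) => [lt2|ge2]; first by rewrite addnS sigma_nth // -addnS.
  have -> : a + d.+1 - size s = 0 by lia.
  by rewrite -sigma_last; congr (sigma (nth _ _ _)); lia.
rewrite ifF; last by apply/negbTE; lia.
by rewrite sigma_nth; [congr nth; lia | lia].
Qed.

(** The orbit stays inside [s], so the first exponent reaching the target is below [size s]; in that
    range the position reached determines the exponent. *)
Lemma findex_sigma_nth a b : a < size s -> b < size s ->
  findex sigma (nth t0 s a) (nth t0 s b) = if a <= b then b - a else size s + b - a.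
Proof.
move=> lta ltb.
have leo : fingraph.order sigma (nth t0 s a) <= size s.
  rewrite -size_orbit; apply: uniq_leq_size; first exact: orbit_uniq.
  move=> y; rewrite -fconnect_orbit => /[dup] cay /iter_findex <-.
  elim: (findex _ _ _) => [|i IHi] /=; first exact: mem_nth.
  case/(nthP t0): IHi => j ltj <-.
  case: (ltnP j.+1 (size s)) => [lt|ge]; first by rewrite sigma_nth ?mem_nth.
  have -> : j = (size s).-1 by move: (ltj : j < size s); lia.
  by rewrite sigma_last mem_nth //; lia.
suff E d' : d' < size s -> a + d' = b \/ a + d' = b + size s ->
    findex sigma (nth t0 s a) (nth t0 s b) = d'.
  by case: leqP => le; apply: E; lia.
move=> ltd' ed'.
have it' : iter d' sigma (nth t0 s a) = nth t0 s b.
  rewrite iter_sigma_nth //; last exact: ltnW.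
  by congr nth; case: ifP; lia.
have cab : fconnect sigma (nth t0 s a) (nth t0 s b) by rewrite -it' fconnect_iter.
have := iter_findex cab; have := leq_trans (findex_max cab) leo.
set d := findex _ _ _ => ltd; rewrite iter_sigma_nth //; last exact: ltnW.
have ltm : (if a + d < size s then a + d else a + d - size s) < size s.
  by case: ifP; lia.
move/eqP; rewrite nth_uniq //.
by case: ifP => ? /eqP; lia.
Qed.

Lemma sigma_segE a b t : a < size s -> b < size s ->
  (t \in sigma_seg sigma (nth t0 s a) (nth t0 s b)) =
  (t \in s) && cyc a b (index t s).
Proof.
move=> lta ltb; rewrite inE; apply/trajectP/andP.
  rewrite findex_sigma_nth // => -[i lti ->].
  have lein : i <= size s by case: ifP lti; lia.
  rewrite iter_sigma_nth //.
  have lt2 : (if a + i < size s then a + i else a + i - size s) < size s.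
    by case: ifP; lia.
  rewrite mem_nth // index_uniq //; split=> //.
  by move: lti; rewrite /cyc; case: ifP; case: ifP; lia.
case=> ts; have ltp : index t s < size s by rewrite index_mem.
set p := index t s in ltp * => cp.
exists (if a <= p then p - a else size s + p - a).
  by rewrite findex_sigma_nth //; move: cp; rewrite /cyc; case: ifP; case: ifP; lia.
rewrite iter_sigma_nth //; last by case: ifP; lia.
rewrite -[LHS](nth_index t0 ts) -/p; congr nth.
by case: ifP; case: ifP; lia.
Qed.

End CyclicOrder.

(* [f j] and [l j] are the positions in [s] of the ends of the interval [A j]. *)
Definition cyclic_presentation (T J : finType) (s : seq T) (f l : J -> nat)
    (A : J -> {set T}) (M : matroid T) :=
  [/\ uniq s /\ ground M =i s, forall j, f j < size s, forall j, l j < size s,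
      forall j t, (t \in A j) = (t \in s) && cyc (f j) (l j) (index t s) &
      antichain A /\ presents A M].

Lemma multi_path_cyclic (T : finType) (M : matroid T) : multi_path M ->
  exists (J : finType) (s : seq T) (f l : J -> nat) (A : J -> {set T}),
    cyclic_presentation s f l A M.
Proof.
move=> [sigma [J [A [[onS cycS] intA antiA presA]]]].
(* On an empty ground set there is no interval, as its ends would have to be elements; otherwise the
   list is the orbit of any element. *)
have [S0|[t0 t0S]] := set_0Vmem (ground M).
  have noJ (j : J) : False by case: (intA j) => f [l []]; rewrite S0 inE.
  exists J, [::], (fun=> 0), (fun=> 0), A; split=> [|j|j|j|] //; try by case: (noJ j).
  by split=> // t; rewrite S0 inE.
pose s := fingraph.orbit sigma t0.
have us : uniq s by apply: orbit_uniq.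
have szs : size s = fingraph.order sigma t0 by apply: size_orbit.
have n0 : 0 < size s by rewrite szs fingraph.order_gt0.
have nths i : i < size s -> nth t0 s i = iter i sigma t0.
  by rewrite szs => lti; rewrite nth_traject.
have memS : ground M =i s.
  move=> t; rewrite -fconnect_orbit; apply/idP/idP => [tS|/iter_findex <-].
    have /porbitP[i ->] := cycS _ _ t0S tS.
    by rewrite permX fconnect_iter.
  by elim: (findex _ _ _) => //= i; rewrite (perm_closed _ onS).
have snth i : i.+1 < size s -> sigma (nth t0 s i) = nth t0 s i.+1.
  by move=> lti; rewrite !nths // ltnW.
have slast : sigma (nth t0 s (size s).-1) = nth t0 s 0.
  rewrite !nths //=; last by rewrite prednK.
  by rewrite -iterS prednK // szs iter_order //; apply: perm_inj.
have [f fP] := fin_all_exists intA; have [l lP] := fin_all_exists fP.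
exists J, s, (fun j => index (f j) s), (fun j => index (l j) s), A.
have fs j : f j \in s by rewrite -memS; case: (lP j).
have ls j : l j \in s by rewrite -memS; case: (lP j).
split=> [|j|j|j t|] //; rewrite ?index_mem //.
have [_ _ ->] := lP j.
by rewrite -{1}(nth_index t0 (fs j)) -{1}(nth_index t0 (ls j)) (sigma_segE us) ?index_mem.
Qed.

Lemma cyclic_multi_path (T J : finType) (s : seq T) (f l : J -> nat) (A : J -> {set T})
  (M : matroid T) : cyclic_presentation s f l A M -> multi_path M.
Proof.
move=> [[us memS] ltf ltl memA [antiA presA]].
pose sigma := perm (can_inj (prev_next us)).
have fixs t : t \notin s -> sigma t = t.
  by move=> ts; rewrite permE next_nth (negbTE ts).
exists sigma, J, A.
have [s0|[t0 t0s]] : s = [::] \/ exists t0, t0 \in s.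
  by case: (s) => [|t0 s']; [left | right; exists t0; rewrite inE eqxx].
  split=> // [|j]; last by have := ltf j; rewrite s0.
  split=> [|x y]; last by rewrite memS s0.
  by apply/subsetP=> t; rewrite inE fixs ?s0 ?eqxx.
have snth i : i < size s ->
    sigma (nth t0 s i) = nth t0 s (if i.+1 < size s then i.+1 else 0).
  move=> lti; rewrite permE next_nth mem_nth // index_uniq //.
  case: (s) lti => //= y p; rewrite !ltnS => lti.
  case: ifP => [lt|ge]; first exact: set_nth_default.
  by rewrite nth_default // leqNgt ge.
have n0 : 0 < size s by case: (s) t0s.
have snth1 i : i.+1 < size s -> sigma (nth t0 s i) = nth t0 s i.+1.
  by move=> lti; rewrite snth ?lti //; lia.
have slast : sigma (nth t0 s (size s).-1) = nth t0 s 0.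
  by rewrite snth; rewrite prednK ?ltnn.
split=> //.
- split; first by apply/subsetP=> t; rewrite !inE memS; apply: contraR => /fixs->.
  move=> x y; rewrite !memS => /(nthP t0)[a lta <-] /(nthP t0)[b ltb <-].
  have {lta ltb} [lta ltb] : a < size s /\ b < size s by [].
  apply/porbitP; exists (if a <= b then b - a else size s + b - a).
  rewrite permX (iter_sigma_nth us snth1) //; last by case: ifP; lia.
  by congr nth; case: ifP; case: ifP; lia.
move=> j; exists (nth t0 s (f j)), (nth t0 s (l j)).
rewrite !memS !mem_nth //; split=> //.
by apply/setP=> t; rewrite (sigma_segE us) // memA.
Qed.

Lemma multi_path_banded (T : finType) (M : matroid T) : multi_path M -> banded M.
Proof.
case/multi_path_cyclic=> J [s [f [l [A [[us memS] ltf ltl memA [antiA presA]]]]]].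
pose lo x := #|[set j | l j < x]|.
pose hi x := #|[set j | l j < f j]| + #|[set j | f j < x]|.
exists s, #|J|, (size s).+1, id, (fun x => (lo x)%:Z)%R, (fun x => (hi x)%:Z)%R.
have sub B : (B \subset ground M) = (B \subset s) by apply: eq_subset_r.
split=> // B; rewrite (cyc_presents_basis us ltf ltl memA antiA) // sub; split.
  case=> cB; rewrite (cyc_transversalP us ltl memA antiA) // => -[sB [c Hc]].
  by split=> //; exists c%:Z%R => x; rewrite ltnS => /Hc; rewrite /lo /hi; lia.
case=> sB cB [c Hc]; split=> //; apply/(cyc_transversalP us ltl memA antiA) => //.
(* The bound at abscissa 0 makes [c] nonnegative. *)
split=> //; exists `|c|%N => x lex.
have := Hc 0 (ltn0Sn _); have := Hc x; rewrite ltnS level0 /lo /hi => /(_ lex).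
by lia.
Qed.

(** * From height bounds to intervals *)

Section HeightPaths.
Variables (n r : nat) (h : nat -> int).

Definition height_path :=
  (forall x, x < n -> (h x <= h x.+1 <= h x + 1)%R) /\ (h n = h 0%N + r%:Z)%R.

Hypothesis hP : height_path.

Lemma height_path_le x y : x <= y <= n -> (h x <= h y <= h x + (y - x)%N%:Z)%R.
Proof.
elim: y => [|y IHy] /andP[lexy leyn]; first by have -> : x = 0; lia.
have [->|neq] := eqVneq x y.+1; first lia.
have := hP.1 y leyn; have := IHy; lia.
Qed.

Lemma height_path_cross v : (h 0%N <= v < h 0%N + r%:Z)%R ->
  exists x, [/\ x < n, h x = v & (h x.+1 = v + 1)%R].
Proof.
move=> /andP[ge lt]; rewrite -hP.2 in lt.
have : forall m, m <= n -> (v < h m)%R ->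
    exists x, [/\ x < n, h x = v & (h x.+1 = v + 1)%R].
  elim=> [|m IHm] lem ltm; first lia.
  have := hP.1 m lem.
  case: (boolP (v < h m)%R) => [lt' _|ge']; first exact: IHm (ltnW lem) lt'.
  by exists m; split=> //; lia.
by move/(_ n (leqnn n) lt).
Qed.

End HeightPaths.

(** * Pointwise extrema of admissible paths *)

Section Extrema.
Variables (T : finType) (s : seq T) (V : {set T} -> int -> bool).
Variables (a : int) (W : nat) (B0 : {set T}) (c0 : int).
Hypotheses (bndV : forall B c, V B c -> (a <= c <= a + W%:Z)%R) (V0 : V B0 c0).

(** Since the starting heights lie in a bounded range, admissible paths are coded by a finite type,
    over which extrema exist. *)
Let P (p : {set T} * 'I_W.+1) := V p.1 (a + (p.2 : nat)%:Z)%R.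

Let code B c : V B c -> exists2 p, P p & p.1 = B /\ (c = a + (p.2 : nat)%:Z)%R.
Proof.
move=> VBc; have bc := bndV VBc.
have ltW : `|c - a|%N < W.+1 by lia.
have ec : (c = a + `|c - a|%N%:Z)%R by lia.
by exists (B, Ordinal ltW); rewrite /P /= -?ec.
Qed.

Lemma level_max : exists F : nat -> int, forall x,
  (forall B c, V B c -> (c + (level s B x)%:Z <= F x)%R) /\
  exists B c, V B c /\ (F x = c + (level s B x)%:Z)%R.
Proof.
have [p0 Pp0 _] := code V0.
pose m x := [arg max_(p > p0 | P p) ((p.2 : nat) + level s p.1 x)].
exists (fun x => a + ((m x).2 : nat)%:Z + (level s (m x).1 x)%:Z)%R => x.
rewrite /m; case: arg_maxnP => // p Pp maxp; split=> [B c /code[q Pq [<- ->]]|].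
  by have := maxp q Pq; rewrite /=; lia.
by exists p.1, (a + (p.2 : nat)%:Z)%R.
Qed.

Lemma level_min : exists L : nat -> int, forall x,
  (forall B c, V B c -> (L x <= c + (level s B x)%:Z)%R) /\
  exists B c, V B c /\ (L x = c + (level s B x)%:Z)%R.
Proof.
have [p0 Pp0 _] := code V0.
pose m x := [arg min_(p < p0 | P p) ((p.2 : nat) + level s p.1 x)].
exists (fun x => a + ((m x).2 : nat)%:Z + (level s (m x).1 x)%:Z)%R => x.
rewrite /m; case: arg_minnP => // p Pp minp; split=> [B c /code[q Pq [<- ->]]|].
  by have := minp q Pq; rewrite /=; lia.
by exists p.1, (a + (p.2 : nat)%:Z)%R.
Qed.

End Extrema.

Section ExtremalPaths.
Variables (T : finType) (s : seq T) (r : nat) (V : {set T} -> int -> bool).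
Hypotheses (us : uniq s).
Hypothesis subV : forall B c, V B c -> B \subset s /\ #|B| = r.

(** The path attaining the maximum at [x] bounds [F x.+1] from below, and the one attaining it at
    [x.+1] bounds [F x] from below; this limits each step of [F] to 0 or 1. All paths rise by [r] in
    total, hence so does [F]. *)
Lemma level_max_path F : (forall x,
    (forall B c, V B c -> (c + (level s B x)%:Z <= F x)%R) /\
    exists B c, V B c /\ (F x = c + (level s B x)%:Z)%R) ->
  height_path (size s) r F.
Proof.
move=> FP; split=> [x ltx|].
  have [B [c [VB e]]] := (FP x).2; have := (FP x.+1).1 B c VB.
  have [B' [c' [VB' e']]] := (FP x.+1).2; have := (FP x).1 B' c' VB'.
  have := level_step s B x; have := level_step s B' x; lia.
have lev B c : V B c -> level s B (size s) = r.
  by move=> /subV[sB <-]; apply: level_size.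
have [B [c [VB e]]] := (FP (size s)).2; have := (FP 0).1 B c VB.
have [B' [c' [VB' e']]] := (FP 0).2; have := (FP (size s)).1 B' c' VB'.
move: e e'; rewrite !level0 (lev _ _ VB) (lev _ _ VB'); lia.
Qed.

Lemma level_min_path L : (forall x,
    (forall B c, V B c -> (L x <= c + (level s B x)%:Z)%R) /\
    exists B c, V B c /\ (L x = c + (level s B x)%:Z)%R) ->
  height_path (size s) r L.
Proof.
move=> LP; split=> [x ltx|].
  have [B [c [VB e]]] := (LP x).2; have := (LP x.+1).1 B c VB.
  have [B' [c' [VB' e']]] := (LP x.+1).2; have := (LP x).1 B' c' VB'.
  have := level_step s B x; have := level_step s B' x; lia.
have lev B c : V B c -> level s B (size s) = r.
  by move=> /subV[sB <-]; apply: level_size.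
have [B [c [VB e]]] := (LP (size s)).2; have := (LP 0).1 B c VB.
have [B' [c' [VB' e']]] := (LP 0).2; have := (LP (size s)).1 B' c' VB'.
move: e e'; rewrite !level0 (lev _ _ VB) (lev _ _ VB'); lia.
Qed.

End ExtremalPaths.

(* With [F] extended to all integers by [F (x + n) = F x + r], this says
   [F (y - (n - r)) <= h y], that is, a North step of [h] comes at most [n - r]
   positions after the North step of [F] at the same height. *)
Definition near_path n r (F h : nat -> int) := forall y, y <= n ->
  (if y + r <= n then (F (y + r)%N - r%:Z <= h y)%R else (F (y + r - n)%N <= h y)%R).

(** Extend both paths periodically, so that they meet at all translates of [x] by multiples of [n].
    If a meeting point lies between [y - (n - r)] and [y], monotonicity is enough. Otherwise both
    abscissas lie between two consecutive meeting points; steps of at most 1 bound [F] from the left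
    one and [h] from the right one, and the two estimates agree. *)
Lemma touching_near_path n r F h x : r <= n -> height_path n r F -> height_path n r h ->
  x <= n -> h x = F x -> near_path n r F h.
Proof.
move=> lern Fp hp lex ehF y ley.
have Fl := height_path_le Fp; have hl := height_path_le hp.
have [Fn hn] := (Fp.2, hp.2).
have F0x := Fl 0 x lex; have Fxn := Fl x n; rewrite lex leqnn in Fxn.
have h0x := hl 0 x lex; have hxn := hl x n; rewrite lex leqnn in hxn.
have h0y := hl 0 y ley; have hyn := hl y n; rewrite ley leqnn in hyn.
move: Fxn hxn hyn => /(_ isT) Fxn /(_ isT) hxn /(_ isT) hyn.
case: (leqP x y) => lexy.
  have hxy : (h x <= h y)%R by have := hl x y; rewrite lexy ley => /(_ isT)/andP[].
  case: leqP => leyr.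
    have := Fl (y + r) n; rewrite leyr leqnn => /(_ isT); lia.
  case: (leqP (y + r - n) x) => lez.
    have := Fl (y + r - n) x; rewrite lez lex => /(_ isT); lia.
  have lezn : y + r - n <= n by lia.
  have := Fl x (y + r - n); rewrite (ltnW lez) lezn => /(_ isT); lia.
have hyx := hl y x; rewrite (ltnW lexy) lex in hyx; move/(_ isT): hyx => hyx.
case: leqP => leyr.
  case: (leqP (y + r) x) => leyx.
    have := Fl (y + r) x; rewrite leyx lex => /(_ isT); lia.
  have := Fl x (y + r); rewrite (ltnW leyx) leyr => /(_ isT); lia.
have lezn : y + r - n <= n by lia.
have := Fl 0 (y + r - n) lezn; lia.
Qed.

Lemma banded_extremal (T : finType) (M : matroid T) : banded M ->
  exists (s : seq T) (r : nat) (F L : nat -> int),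
  [/\ uniq s /\ ground M =i s, r <= size s, height_path (size s) r F,
      height_path (size s) r L &
    [/\ forall x, x <= size s -> (L x <= F x)%R, near_path (size s) r F L &
    forall B : {set T}, basis M B <-> [/\ B \subset s, #|B| = r &
        exists c : int, forall x, x <= size s -> (L x <= c + (level s B x)%:Z <= F x)%R]]].
Proof.
move=> [s [r [N [pos [lo [hi [us memS N0 lepos bas]]]]]]].
have sub (B : {set T}) : (B \subset ground M) = (B \subset s) by apply: eq_subset_r.
pose V (B : {set T}) (c : int) := [&& B \subset s, #|B| == r &
  [forall z : 'I_N, lo z <= c + (level s B (pos z))%:Z <= hi z]%R].
have VP (B : {set T}) (c : int) : reflect [/\ B \subset s, #|B| = r & forall z, z < N ->
    (lo z <= c + (level s B (pos z))%:Z <= hi z)%R] (V B c).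
  apply: (iffP and3P) => -[? /eqP ? H]; split=> //.
    by move=> z ltz; have := forallP H (Ordinal ltz).
  by apply/forallP=> z; apply: H.
have basV B : basis M B <-> exists c, V B c.
  rewrite bas sub; split=> [[? ? [c ?]]|[c /VP[? ? ?]]]; last by split=> //; exists c.
  by exists c; apply/VP.
have [B0 /[dup] bB0 /basV[c0 V0]] := ex_basis M.
have ler : r <= size s.
  case/VP: V0 => sB <- _; rewrite -(card_uniqP us); exact: subset_leq_card.
(* Bound number 0 confines the height at one abscissa, hence the starting height, to a finite
   range. *)
have bnd B c : V B c -> (lo 0%N - (size s)%:Z <= c <=
    (lo 0%N - (size s)%:Z) + `|(hi 0%N - lo 0%N + (size s)%:Z)%R|%N%:Z)%R.
  case/VP=> _ _ /(_ 0 N0); have := level_leq s B (pos 0); have := lepos 0 N0; lia.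
have subV B c : V B c -> B \subset s /\ #|B| = r by case/VP.
have [F FP] := level_max s bnd V0; have Fp := level_max_path us subV FP.
have Fhi z : z < N -> (F (pos z) <= hi z)%R.
  by move=> ltz; have [B [c [/VP[_ _ H] ->]]] := (FP (pos z)).2; have := H z ltz; lia.
pose near (B : {set T}) (c : int) (y : nat) :=
  if y + r <= size s then (F (y + r)%N - r%:Z <= c + (level s B y)%:Z)%R
  else (F (y + r - size s)%N <= c + (level s B y)%:Z)%R.
pose V' B c := V B c && [forall y : 'I_(size s).+1, near B c y].
have V'P B c : reflect (V B c /\
    near_path (size s) r F (fun y => c + (level s B y)%:Z)%R) (V' B c).
  apply: (iffP andP) => -[VB H]; split=> //.
    by move=> y ley; have := forallP H (Ordinal (ley : y < (size s).+1)).
  by apply/forallP=> y; apply: (H y); rewrite -ltnS.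
(* Raise the path by its smallest gap below [F]. It stays below [F], hence below [hi], it can only
   move away from [lo], and it touches [F], hence is near [F]. *)
have VV' B c : V B c -> exists c', V' B c'.
  move=> VB; pose gap (x : 'I_(size s).+1) := `|(F x - (c + (level s B x)%:Z))%R|%N.
  pose x := [arg min_(x < (ord0 : 'I_(size s).+1) | true) gap x].
  have minx y : y <= size s -> (c + (gap x)%:Z + (level s B y)%:Z <= F y)%R.
    move=> ley; have := (FP y).1 B c VB.
    have : gap x <= gap (Ordinal (ley : y < (size s).+1)).
      by rewrite /x; case: arg_minnP => // ? _; apply.
    by rewrite {2}/gap /=; lia.
  have ex : (c + (gap x)%:Z + (level s B x)%:Z = F x)%R.
    by have := (FP x).1 B c VB; rewrite /gap; lia.
  have [sB cB] := subV _ _ VB.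
  exists (c + (gap x)%:Z)%R; apply/V'P; split.
    case/VP: (VB) => _ _ H; apply/VP; split=> // z ltz.
    have := H z ltz; have := Fhi z ltz; have := minx _ (lepos z ltz); lia.
  apply: (touching_near_path ler Fp _ (_ : x <= size s) ex); last by rewrite -ltnS.
  split=> [y _|]; first by have := level_step s B y; lia.
  by rewrite level0 level_size // cB; lia.
have [c0' V0'] := VV' _ _ V0.
have bnd' B c : V' B c -> (lo 0%N - (size s)%:Z <= c <=
    (lo 0%N - (size s)%:Z) + `|(hi 0%N - lo 0%N + (size s)%:Z)%R|%N%:Z)%R.
  by case/V'P=> /bnd.
have subV' B c : V' B c -> B \subset s /\ #|B| = r by case/V'P=> /subV.
have [L LP] := level_min s bnd' V0'; have Lp := level_min_path us subV' LP.
exists s, r, F, L; split=> //; split.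
- move=> x _; have [B [c [/V'P[/(FP x).1 le _] ->]]] := (LP x).2; exact: le.
- move=> y ley; have [B [c [/V'P[_ H] ->]]] := (LP y).2; exact: H.
move=> B; split=> [/basV[c VB]|[sB cB [c Hc]]].
  have [c' V'B] := VV' _ _ VB; have [VB' _] := V'P _ _ V'B.
  have [sB cB] := subV _ _ VB; split=> //; exists c' => x _.
  by rewrite (LP x).1 //= (FP x).1.
apply/basV; exists c; apply/VP; split=> // z ltz.
have := Hc _ (lepos z ltz); have := Fhi z ltz.
have [B' [c' [/V'P[/VP[_ _ H] _] ->]]] := (LP (pos z)).2; have := H z ltz; lia.
Qed.

Lemma card_ord_ltn r u : u <= r -> #|[set j : 'I_r | j < u]| = u.
Proof.
move=> leur; rewrite -[RHS]card_ord -cardsT.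
have injw : injective (widen_ord leur) by move=> i j /(congr1 val) /= /val_inj.
rewrite -(card_imset _ injw); apply: eq_card => j; rewrite !inE.
apply/idP/imsetP => [ltj|[i _ ->]]; last exact: (ltn_ord i).
by exists (Ordinal ltj); [rewrite inE | apply: val_inj].
Qed.

(** In the cyclic order starting at [k], the set consists of the first [u] indices. Adding the
    indices below [k] to the count turns it into the count of two initial segments. *)
Lemma card_ord_rot r k u : k <= r -> u <= r ->
  #|[set j : 'I_r | if k <= j then j < u + k else j + r < u + k]| = u.
Proof.
move=> lek leu.
have sum : \sum_(j < r) ((if k <= j then j < u + k else j + r < u + k) : bool) +
    \sum_(j < r) (j < k) =
    \sum_(j < r) (j < minn (u + k) r) + \sum_(j < r) (j < u + k - r).
  rewrite -!big_split; apply: eq_bigr => j _ /=.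
  by have := ltn_ord j; case: ifP; lia.
move: sum; rewrite -!card_set_sum !card_ord_ltn ?geq_minr //; last lia.
by move=> sum; apply/(@addIn k); rewrite sum; lia.
Qed.

(* Only when the second interval is not the whole cycle do the relative positions of
   the ends exclude inclusion. *)
Lemma cyc_not_sub n fi li fj lj : fi < n -> li < n -> fj < n -> lj < n ->
    fj != lj.+1 -> ~~ ((fj == 0) && (lj.+1 == n)) ->
    (if (li < fi) == (lj < fj) then (fi < fj) && (li < lj) || (fj < fi) && (lj < li)
     else if li < fi then (li < lj) && (fj < fi) else (lj < li) && (fi < fj)) ->
  exists p, [/\ p < n, cyc fi li p & ~~ cyc fj lj p].
Proof.
move=> ltfi ltli ltfj ltlj ne1 ne2; rewrite /cyc.
case: (ltnP li fi) => wi; case: (ltnP lj fj) => wj /=.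
- case/orP=> /andP[lt1 lt2].
    case: (ltnP lj fi) => ?; first by exists fi; split; lia.
    by exists fj.-1; split; lia.
  case: (ltnP li fj) => ?; first by exists li; split; lia.
  by exists fj.-1; split; lia.
- case/andP=> lt1 lt2; case: (ltnP li fj) => ?; first by exists li; split; lia.
  case: (posnP fj) => ?; first by exists n.-1; split; lia.
  by exists fj.-1; split; lia.
- case/andP=> lt1 lt2; case: (ltnP li fj) => ?; first by exists li; split; lia.
  by exists fj.-1; split; lia.
case/orP=> /andP[lt1 lt2]; first by exists fi; split; lia.
by exists li; split; lia.
Qed.

Lemma banded_multi_path (T : finType) (M : matroid T) : banded M -> multi_path M.
Proof.
case/banded_extremal=> s [r [F [L [[us memS] ler Fp Lp [leLF nearL bas]]]]].
have Fl := height_path_le Fp; have Ll := height_path_le Lp.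
have [Fn Ln] := (Fp.2, Lp.2).
(* [k] is to be the number of intervals crossing the cut. It is at most [r] because [L] is near [F]
   at abscissa 0. *)
have ek : exists2 k : nat, k <= r & (F 0%N = L 0%N + k%:Z)%R.
  exists `|(F 0%N - L 0%N)%R|%N; have := leLF 0 (leq0n _);
    have := nearL 0 (leq0n _); rewrite add0n ler; have := Fl 0 r; lia.
case: ek => k lek Fk.
have [l lP] : exists l : 'I_r -> nat, forall j, [/\ l j < size s,
    (L (l j) = L 0%N + j%:Z)%R & (L (l j).+1 = L 0%N + j%:Z + 1)%R].
  apply: (fin_all_exists (P := fun (j : 'I_r) x => [/\ x < size s,
    (L x = L 0%N + j%:Z)%R & (L x.+1 = L 0%N + j%:Z + 1)%R])) => j.
  by apply: (height_path_cross Lp); have := ltn_ord j; lia.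
(* Interval [j] runs from a North step of [F] to one of [L] at the same height modulo [r]. As [F]
   starts [k] above [L], it takes the heights of index below [k] only one period later, whence the
   term [(j < k) * r]. *)
have [f fP] : exists f : 'I_r -> nat, forall j, [/\ f j < size s,
    (F (f j) = L 0%N + (j + (j < k) * r)%N%:Z)%R
  & (F (f j).+1 = L 0%N + (j + (j < k) * r)%N%:Z + 1)%R].
  apply: (fin_all_exists (P := fun (j : 'I_r) x => [/\ x < size s,
    (F x = L 0%N + (j + (j < k) * r)%N%:Z)%R
  & (F x.+1 = L 0%N + (j + (j < k) * r)%N%:Z + 1)%R])) => j.
  by apply: (height_path_cross Fp); have := ltn_ord j; case: (ltnP j k); lia.
have ltf j : f j < size s by case: (fP j).
have ltl j : l j < size s by case: (lP j).
have lltE j x : x <= size s -> (l j < x) = (L 0%N + j%:Z < L x)%R.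
  have [_ e1 e2] := lP j; have := ltl j; move=> ? lex.
  by have := Ll (l j).+1 x; have := Ll x (l j); lia.
have fltE j x : x <= size s ->
    (f j < x) = (L 0%N + (j + (j < k) * r)%N%:Z < F x)%R.
  have [_ e1 e2] := fP j; have := ltf j; move=> ? lex.
  by have := Fl (f j).+1 x; have := Fl x (f j); lia.
(* For [j < k] nearness makes [L] pass its height before [F] reaches that height one period up; for
   [k <= j] the relation [L <= F] puts the step of [F] first. *)
have wrapE j : (l j < f j) = (j < k).
  have [_ e1 e2] := lP j; have [ltfj e3 e4] := fP j; have := ltn_ord j.
  case: (ltnP j k) e3 e4 => [ltjk|lekj] e3 e4 ltjr.
    rewrite lltE; last exact: ltnW.
    have := nearL (f j) (ltnW ltfj).
    case: ifP => le; first by have := Fl (f j).+1 (f j + r); lia.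
    by have := Fl 0 (f j + r - size s); have := Fl (f j).+1 (size s); lia.
  apply/negbTE; rewrite -leqNgt -ltnS.
  have := ltl j; rewrite fltE //; have := leLF (l j).+1 (ltl j); lia.
pose A j := [set t | (t \in s) && cyc (f j) (l j) (index t s)].
have memA j t : (t \in A j) = (t \in s) && cyc (f j) (l j) (index t s).
  by rewrite inE.
have short j : 1 < r -> f j != (l j).+1 /\ ~~ ((f j == 0) && ((l j).+1 == size s)).
  move=> r1; have [ltlj e1 e2] := lP j; have [ltfj e3 e4] := fP j.
  have := wrapE j; have jr := ltn_ord j.
  split.
    apply/eqP=> efl; move: (wrapE j); rewrite efl ltnS leqnn => /esym ltjk.
    move: e3 e4; rewrite ltjk mul1n efl => e3 e4.
    have := nearL (l j) (ltnW ltlj); have := ltf j; rewrite efl => ltl2.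
    case: ifP => le; first by have := Fl (l j).+2 (l j + r); lia.
    by have := Fl 0 (l j + r - size s); have := Fl (l j).+2 (size s); lia.
  apply/negP=> /andP[/eqP f0 /eqP ln].
  move: e3 e4; rewrite f0 (_ : (j < k) = false) ?mul0n ?addn0; last by rewrite -wrapE f0.
  move=> e3 e4; have := nearL (l j) (ltnW ltlj); case: ifP => le; first lia.
  by have := Fl 1 (l j + r - size s); lia.
have antiA : antichain A.
  apply/(cyc_antichainP us memA) => i j neq.
  have r1 : 1 < r by move: neq (ltn_ord i) (ltn_ord j); rewrite -val_eqE /=; lia.
  have lij : (l i < l j) = (i < j).
    by rewrite lltE; [have [_ -> _] := lP j; lia | apply: ltnW].
  have lji : (l j < l i) = (j < i).
    by rewrite lltE; [have [_ -> _] := lP i; lia | apply: ltnW].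
  have fij : (f i < f j) = (i + (i < k) * r < j + (j < k) * r).
    by rewrite fltE; [have [_ -> _] := fP j; lia | apply: ltnW].
  have fji : (f j < f i) = (j + (j < k) * r < i + (i < k) * r).
    by rewrite fltE; [have [_ -> _] := fP i; lia | apply: ltnW].
  have [sj sj'] := short j r1.
  apply: cyc_not_sub => //; rewrite !wrapE lij lji fij fji.
  have := ltn_ord i; have := ltn_ord j; move: neq; rewrite -val_eqE /=.
  move: (i : nat) (j : nat); clear => a b neq ltb lta.
  by case: (ltnP a k); case: (ltnP b k) => /= *; lia.
apply: (@cyclic_multi_path T 'I_r s f l A); split=> //; split=> //.
have sA j : A j \subset ground M.
  by apply/subsetP => t; rewrite inE memS => /andP[].
split=> // X; pose M' := transversal_matroid sA.
suff -> : indep M = indep M' by rewrite inE.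
apply: eq_basis_indep => B.
rewrite (cyc_presents_basis us ltf ltl memA antiA _ (presents_transversal_matroid sA)).
have cL x : x <= size s -> (#|[set j | (l j < x)%N]|%:Z = L x - L 0%N)%R.
  move=> lex; rewrite (_ : [set j | l j < x] = [set j : 'I_r | j < `|(L x - L 0%N)%R|%N]).
    by rewrite card_ord_ltn; have := Ll 0 x; have := Ll x (size s); lia.
  by apply/setP=> j; rewrite !inE lltE //; have := Ll 0 x; lia.
(* [F] takes its North steps in the cyclic order of the indices starting at [k]. *)
have cF x : x <= size s -> (#|[set j | (f j < x)%N]|%:Z = F x - F 0%N)%R.
  move=> lex; rewrite (_ : [set j | f j < x] = [set j : 'I_r |
      if k <= j then j < `|(F x - F 0%N)%R|%N + k else j + r < `|(F x - F 0%N)%R|%N + k]).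
    by rewrite card_ord_rot //; have := Fl 0 x; have := Fl x (size s); lia.
  apply/setP=> j; rewrite !inE fltE //; have := Fl 0 x.
  by case: (leqP k j); lia.
have cW : #|[set j | l j < f j]| = k.
  by rewrite (eq_card (B := [set j : 'I_r | j < k])) ?card_ord_ltn // => j; rewrite !inE.
split=> [/bas[sB cB [c Hc]]|[cB]].
  rewrite card_ord; split=> //; apply/(cyc_transversalP us ltl memA antiA).
    by rewrite card_ord.
  split=> //; exists `|(c - L 0%N)%R|%N => x lex.
  have := Hc 0 (leq0n _); rewrite level0.
  by have := Hc x lex; have := cL x lex; have := cF x lex; rewrite cW; lia.
rewrite (cyc_transversalP us ltl memA antiA) // => -[sB [c Hc]].
apply/bas; split=> //; first by rewrite cB card_ord.
exists (c%:Z + L 0%N)%R => x lex.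
by have := Hc x lex; have := cL x lex; have := cF x lex; rewrite cW; lia.
Qed.

(** * Lattice path matroids *)

Lemma val_preimset (T : finType) (M : matroid T) (B : {set T}) : B \subset ground M ->
  val @: (val @^-1: B : {set {x | x \in ground M}}) = B.
Proof.
move=> sB; apply/setP=> x; apply/imsetP/idP => [[u]|xB]; first by rewrite inE => ? ->.
by exists (exist _ x (subsetP sB x xB)); rewrite ?inE.
Qed.

(** The list is the image of [s'] under the inverse bijection, so a set and its image have the same
    path. *)
Lemma isomorphic_level (T T' : finType) (M : matroid T) (M' : matroid T') (s' : seq T') :
  isomorphic M M' -> uniq s' -> ground M' =i s' ->
  exists (s : seq T) (phi : {set T} -> {set T'}),
    [/\ uniq s, ground M =i s, size s = size s' &
        forall B : {set T}, B \subset ground M ->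
        [/\ phi B \subset ground M', #|phi B| = #|B|, basis M B <-> basis M' (phi B) &
            forall x, level s B x = level s' (phi B) x]].
Proof.
move=> [f [g fK gK] iso] us' memS'.
have injf := can_inj fK; have injg := can_inj gK.
pose t : seq {y | y \in ground M'} := pmap insub s'.
have valt : map val t = s'.
  rewrite /t (pmap_filter (@insubK _ _ _)); apply/all_filterP/allP => y ys.
  by rewrite isSome_insub memS'.
have memt y : y \in t by rewrite mem_pmap_sub /= -memS' (valP y).
pose phi (B : {set T}) : {set T'} :=
  val @: (f @: (val @^-1: B : {set {x | x \in ground M}})).
exists (map (val \o g) t), phi.
have cphi (B : {set T}) : B \subset ground M -> #|phi B| = #|B|.
  move=> sB; rewrite card_imset; last exact: val_inj.
  by rewrite card_imset // -[in RHS](val_preimset sB) card_imset //; apply: val_inj.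
have iphi (B : {set T}) : B \subset ground M -> (B \in indep M) = (phi B \in indep M').
  by move=> sB; rewrite -iso val_preimset.
split.
- rewrite map_inj_uniq; last by move=> x y /val_inj/injg.
  by apply: (map_uniq (f := val)); rewrite valt.
- move=> x; apply/idP/mapP => [xS|[y _ ->]]; last exact: (valP (g y)).
  by exists (f (exist _ x xS)); rewrite //= fK.
- by rewrite size_map -valt size_map.
move=> B sB; split; first by apply/subsetP=> _ /imsetP[y _ ->]; apply: (valP y).
- exact: cphi.
- split=> /basisP[iB mB]; apply/basisP; (split; first by rewrite ?iphi // -iphi) => X iX.
    have sX := indep_ground iX.
    pose Y := g @: (val @^-1: X : {set {y | y \in ground M'}}).
    have eX : X = val @: (f @: Y).
      have -> : f @: Y = val @^-1: X by rewrite -imset_comp (eq_imset _ gK) imset_id.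
      by rewrite val_preimset.
    have := mB (val @: Y); rewrite iso -eX iX => /(_ isT).
    rewrite cphi //; apply: leq_trans.
    by rewrite eX !card_imset //; apply: val_inj.
  rewrite -(cphi X) ?indep_ground // -(cphi B) //; apply: mB.
  by rewrite -iphi // indep_ground.
move=> x; rewrite /level -valt -!map_take !count_map; apply: eq_count => y /=.
rewrite mem_imset; last exact: val_inj.
by rewrite -{2}(gK y) mem_imset // inE.
Qed.

Section LatticePathMatroids.
Variables m r : nat.
Implicit Types (p P Q : (m + r).-tuple bool).

Lemma heightS p (k : 'I_(m + r)) : height p k.+1 = height p k + tnth p k.
Proof.
rewrite /height (take_nth false) ?size_tuple // -cats1 count_cat /= addn0.
by rewrite (tnth_nth false).
Qed.

Lemma height_size p : lattice_path p -> height p (m + r) = r.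
Proof. by case/andP=> _ /eqP; rewrite /height take_oversize ?size_tuple. Qed.

Lemma lattice_path_height p :
  lattice_path p -> height_path (m + r) r (fun x => (height p x)%:Z)%R.
Proof.
move=> lp; split=> [x ltx|]; last by rewrite height_size // /height take0 /=; lia.
by rewrite (heightS p (Ordinal ltx)) /=; case: (tnth _ _); lia.
Qed.

Lemma path_of_height (h : nat -> nat) : h 0 = 0 -> h (m + r) = r ->
    (forall x, x < m + r -> h x <= h x.+1 <= (h x).+1) ->
  exists2 p : (m + r).-tuple bool, lattice_path p & forall x, x <= m + r -> height p x = h x.
Proof.
move=> h0 hn hS; pose p := [tuple h i < h i.+1 | i < m + r].
have hp x : x <= m + r -> height p x = h x.
  elim: x => [|x IHx] ltx; first by rewrite /height take0 h0.
  rewrite (heightS p (Ordinal ltx)) IHx ?tnth_mktuple /=; last exact: ltnW.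
  by have := hS x ltx; lia.
exists p => //; rewrite /lattice_path.
have cp : count id p = r by rewrite -[RHS]hn -hp // /height take_oversize ?size_tuple.
have := count_predC id p; rewrite size_tuple cp eqxx andbT => e.
by apply/eqP/(@addnI r); rewrite [RHS]addnC; apply: etrans e.
Qed.

Variables P Q : (m + r).-tuple bool.
Hypotheses (lP : lattice_path P) (lQ : lattice_path Q) (PQ : never_above P Q).

Lemma height_leq_never_above p q x : never_above p q -> x <= m + r -> height p x <= height q x.
Proof. by move=> /forallP pq lex; apply: (pq (Ordinal (lex : x < (m + r).+1))). Qed.

(** This exhibits each [north_set] as an interval, from the North step of [Q] at height [i] to that
    of [P], so that the criterion for cyclic intervals applies. *)
Lemma mem_north_set i (k : 'I_(m + r)) : (k \in north_set P Q i) =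
  (i < height Q k.+1) && (height P k <= i).
Proof.
have ltk := ltn_ord k.
rewrite inE; apply/existsP/andP.
  case=> p /and4P[lp Pp pQ /andP[pk /eqP pi]].
  have := height_leq_never_above pQ ltk; have := height_leq_never_above Pp (ltnW ltk).
  by rewrite heightS pk pi; lia.
case=> iQ Pi.
(* The bounding paths clamped to height [i] up to position [k], to [i.+1] after it. *)
pose h x := maxn (height P x) (minn (height Q x) (if x <= k then i : nat else i.+1)).
have PQx x := @height_leq_never_above P Q x PQ.
have SP x : x < m + r -> height P x <= height P x.+1 <= (height P x).+1.
  by move=> ltx; rewrite (heightS P (Ordinal ltx)) /=; case: (tnth _ _); lia.
have SQ x : x < m + r -> height Q x <= height Q x.+1 <= (height Q x).+1.
  by move=> ltx; rewrite (heightS Q (Ordinal ltx)) /=; case: (tnth _ _); lia.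
have hk : h k = i /\ h k.+1 = i.+1.
  have := SP k ltk; have := SQ k ltk; rewrite /h leqnn ltnn.
  have := PQx k (ltnW ltk); have := PQx k.+1 ltk; lia.
have [||x ltx|p lp hp] := @path_of_height h.
- by rewrite /h /height !take0 /=; lia.
- by rewrite /h !height_size //; lia.
- have [->|nek] := eqVneq x k; first lia.
  have := SP x ltx; have := SQ x ltx; have := PQx x (ltnW ltx); have := PQx x.+1 ltx.
  by rewrite /h; case: (leqP x k); case: (ltnP x k); lia.
exists p; apply/and4P; split=> //.
- apply/forallP=> x; have lex : x <= m + r by rewrite -ltnS.
  by rewrite hp // /h; lia.
- apply/forallP=> x; have lex : x <= m + r by rewrite -ltnS.
  by have := PQx x lex; rewrite hp // /h; lia.
have := hp k.+1 ltk; have := hp k (ltnW ltk); rewrite /north_step heightS.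
by case: (tnth p k) => /=; lia.
Qed.

(** First and last elements both increase with the index, so the intervals form an antichain. None
    crosses the cut because [P] is never above [Q]; the bounds at abscissa 0 then force the starting
    height to be 0. *)
Lemma lpm_basis (B : {set 'I_(m + r)}) : basis (lpm P Q) B <->
  #|B| = r /\ forall x, x <= m + r -> height P x <= level (enum 'I_(m + r)) B x <= height Q x.
Proof.
set s := enum 'I_(m + r).
have us : uniq s by apply: enum_uniq.
have szs : size s = m + r by rewrite size_enum_ord.
have Pp := lattice_path_height lP; have Qp := lattice_path_height lQ.
have Pl := height_path_le Pp; have Ql := height_path_le Qp.
have P0 : height P 0 = 0 by rewrite /height take0.
have Q0 : height Q 0 = 0 by rewrite /height take0.
have cross p : lattice_path p -> exists f : 'I_r -> nat, forall i,
    [/\ f i < m + r, height p (f i) = i & height p (f i).+1 = i.+1].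
  move=> lp; apply: (fin_all_exists (P := fun (i : 'I_r) x =>
    [/\ x < m + r, height p x = i & height p x.+1 = i.+1])) => i.
  have [|x [ltx e1 e2]] := height_path_cross (v := i%:Z%R) (lattice_path_height lp).
    by rewrite {1 2}/height take0 /=; have := ltn_ord i; lia.
  by exists x; split=> //; lia.
have [f fP] := cross Q lQ; have [l lP'] := cross P lP.
have ltf i : f i < size s by rewrite szs; case: (fP i).
have ltl i : l i < size s by rewrite szs; case: (lP' i).
have lltE i x : x <= m + r -> (l i < x) = (i < height P x).
  move=> lex; have [? e1 e2] := lP' i.
  by have := Pl (l i).+1 x; have := Pl x (l i); lia.
have fltE i x : x <= m + r -> (f i < x) = (i < height Q x).
  move=> lex; have [? e1 e2] := fP i.
  by have := Ql (f i).+1 x; have := Ql x (f i); lia.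
have lefl i : f i <= l i.
  rewrite -ltnS; have [lti _ e] := lP' i; rewrite fltE //.
  by have := height_leq_never_above PQ lti; lia.
have memN i (t : 'I_(m + r)) : (t \in north_set P Q i) =
    (t \in s) && cyc (f i) (l i) (index t s).
  rewrite mem_north_set mem_enum index_enum_ord /cyc [t \in _]inE /=; have ltt := ltn_ord t.
  by rewrite -fltE // (leqNgt (height P t)) -lltE; [have := lefl i; lia | apply: ltnW].
have antiN : antichain (north_set P Q).
  apply/(cyc_antichainP us memN) => i j; rewrite -val_eqE /= neq_ltn => /orP[] ltij.
    exists (f i); split=> //; rewrite /cyc; have := lefl i; have := lefl j.
      lia.
    have := fltE i (f j); have := ltf j; rewrite szs; have [_ -> _] := fP j; lia.
  exists (l i); split=> //; rewrite /cyc; have := lefl i; have := lefl j.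
    lia.
  have := lltE j (l i); have := ltl i; rewrite szs; have [_ -> _] := lP' i; lia.
have cl x : x <= m + r -> #|[set j | l j < x]| = height P x.
  move=> lex; have le : height P x <= r.
    by have := Pl x (m + r); rewrite (height_size lP); lia.
  rewrite -[RHS](card_ord_ltn le); apply: eq_card => j.
  by rewrite !inE lltE.
have cf x : x <= m + r -> #|[set j | f j < x]| = height Q x.
  move=> lex; have le : height Q x <= r.
    by have := Ql x (m + r); rewrite (height_size lQ); lia.
  rewrite -[RHS](card_ord_ltn le); apply: eq_card => j.
  by rewrite !inE fltE.
have cw : #|[set j | l j < f j]| = 0.
  by apply: eq_card0 => j; rewrite inE ltnNge lefl.
rewrite (cyc_presents_basis us ltf ltl memN antiN _ (presents_transversal_matroid _)).
rewrite card_ord; split=> -[cB].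
  rewrite (cyc_transversalP us ltl memN antiN) ?card_ord // => -[_ [c]].
  rewrite szs cw => Hc; split=> // x lex; have := Hc x lex; rewrite cl // cf //.
  by have := Hc 0 (leq0n _); rewrite level0 cf // Q0; lia.
move=> Hc; split=> //; apply/(cyc_transversalP us ltl memN antiN); first by rewrite card_ord.
split; first by apply/subsetP=> t _; rewrite mem_enum.
by exists 0 => x; rewrite szs => lex; rewrite cw cl // cf // !add0n Hc.
Qed.

End LatticePathMatroids.

Lemma lattice_path_matroid_level (T : finType) (M : matroid T) :
  lattice_path_matroid M -> exists (s : seq T) (r : nat) (lo hi : nat -> nat),
    [/\ uniq s, ground M =i s & forall B : {set T}, basis M B <->
      [/\ B \subset ground M, #|B| = r &
          forall x, x <= size s -> lo x <= level s B x <= hi x]].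
Proof.
move=> [m [r [P [Q [lP lQ PQ iso]]]]].
have [||s [phi [us memS szs phiP]]] := isomorphic_level (s' := enum 'I_(m + r)) iso.
- exact: enum_uniq.
- by move=> i; rewrite inE mem_enum.
exists s, r, (height P), (height Q); split=> // B.
split=> [bB|[sB cB HB]].
  have sB := basis_ground bB; have [_ cphi basphi lev] := phiP B sB.
  have [cB HB] := (lpm_basis lP lQ PQ _).1 (basphi.1 bB).
  split=> //; first by rewrite -cphi.
  by move=> x; rewrite szs size_enum_ord lev => /HB.
have [_ cphi basphi lev] := phiP B sB.
apply/basphi/(lpm_basis lP lQ PQ); split; first by rewrite cphi.
by move=> x lex; rewrite -lev HB // szs size_enum_ord.
Qed.

Lemma lattice_path_banded (T : finType) (M : matroid T) :
  lattice_path_matroid M -> banded M.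
Proof.
move=> /lattice_path_matroid_level[s [r [lo [hi [us memS bas]]]]].
(* Bound 0 pins the starting height to 0, and bound [x.+1] is the one at abscissa [x]; thus abscissa
   0 carries two bounds. *)
exists s, r, (size s).+2, (fun z => z.-1), (fun z => if z is x.+1 then (lo x)%:Z%R else 0%R),
  (fun z => if z is x.+1 then (hi x)%:Z%R else 0%R).
split=> [||||B] //; first by case=> [|z] //=; rewrite !ltnS.
rewrite bas; split=> -[sB cB H]; split=> //.
  by exists 0%R => -[|x]; rewrite ?level0 //= !ltnS => /H; lia.
move=> x lex; case: H => c H; have := H 0 (ltn0Sn _); have := H x.+1.
by rewrite !ltnS level0 /= => /(_ lex); lia.
Qed.

(** * The 3-whirl *)

(** Around a hexagon these are the arcs 0 1 2, 2 3 4 and 4 5 0. *)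
Definition whirl_in (i t : nat) := cyc i.*2 (nth 0 [:: 2; 4; 0] i) t.

Definition whirl_set (i : 'I_3) : {set 'I_6} := [set t : 'I_6 | whirl_in i t].

Definition whirl := transversal_matroid (fun i => subsetT (whirl_set i)).

Definition whirl_line (i : 'I_3) := ~: whirl_set i.

Lemma whirl_cyclic : cyclic_presentation (enum 'I_6)
  (fun i : 'I_3 => i.*2) (fun i : 'I_3 => nth 0 [:: 2; 4; 0] i) whirl_set whirl.
Proof.
have memA (i : 'I_3) (t : 'I_6) : (t \in whirl_set i) = (t \in enum 'I_6) &&
    cyc i.*2 (nth 0 [:: 2; 4; 0] i) (index t (enum 'I_6)).
  by rewrite inE mem_enum index_enum_ord.
split=> //; rewrite ?size_enum_ord.
- by split; [apply: enum_uniq | move=> t; rewrite inE mem_enum].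
- by move=> [[|[|[|]]]].
- by move=> [[|[|[|]]]].
split; last exact: presents_transversal_matroid.
apply/(cyc_antichainP (enum_uniq _) memA) => i j neq; rewrite size_enum_ord.
(* The middle element of an arc lies in no other arc. *)
by exists i.*2.+1; move: neq; case: i => [[|[|[|]]]] // ?; case: j => [[|[|[|]]]].
Qed.

Lemma whirl_basis B : basis whirl B <-> #|B| = 3 /\ partial_transversal whirl_set B.
Proof.
have [[us _] ltf ltl memA [antiA presA]] := whirl_cyclic.
by rewrite (cyc_presents_basis us ltf ltl memA antiA) // card_ord.
Qed.

Lemma card_ord_count n (P : pred nat) : #|[set t : 'I_n | P t]| = count P (iota 0 n).
Proof. by rewrite cardsE cardE size_filter -val_enum_ord count_map -enumT; apply: eq_count. Qed.

(** A test by computation: entry [i] of the list represents arc [i], and the count ensures that all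
    entries are below 6. *)
Lemma whirl_list_basis (p : seq nat) :
    [&& uniq p, size p == 3, count [in p] (iota 0 6) == 3 &
        all (fun i => whirl_in i (nth 0 p i)) (iota 0 3)] ->
  basis whirl [set t : 'I_6 | (t : nat) \in p].
Proof.
case/and4P=> up /eqP sp /eqP cp /allP wp; apply/whirl_basis; rewrite card_ord_count.
split=> //; apply/partial_transversalP.
exists (fun t : 'I_6 => Some (inord (index (t : nat) p) : 'I_3)).
have lti (t : 'I_6) : (t : nat) \in p -> index (t : nat) p < 3 by rewrite -index_mem sp.
split=> [t t'|t]; rewrite !inE.
  move=> tp t'p [/(congr1 val)]; rewrite /= !inordK ?lti // => e.
  by apply: val_inj; rewrite /= -(nth_index 0 tp) e nth_index.
move=> tp; exists (inord (index (t : nat) p)) => //; rewrite inE inordK ?lti //.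
by rewrite -{2}(nth_index 0 tp) wp // mem_iota lti.
Qed.

Lemma card_whirl_line i : #|whirl_line i| = 3.
Proof.
have -> : whirl_line i = [set t : 'I_6 | ~~ whirl_in i t] by apply/setP=> t; rewrite !inE.
by rewrite (card_ord_count _ (fun t => ~~ whirl_in i t)); case: i => [[|[|[|]]]].
Qed.

(** The three points of the line would have to be matched with the two arcs other than [i]. *)
Lemma whirl_line_nonbasis i : ~ basis whirl (whirl_line i).
Proof.
move=> /whirl_basis[_ /partial_transversalP[f [injf fA]]].
have := card_whirl_line i; rewrite -(card_in_imset injf) => c3.
have /subset_leq_card : f @: whirl_line i \subset Some @: [set~ i].
  apply/subsetP=> _ /imsetP[t tL ->]; have [j -> tj] := fA t tL.
  by apply/imset_f; rewrite !inE; apply: contraL tL => /eqP <-; rewrite inE negbK.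
by rewrite c3 card_imset ?cardsC1 ?card_ord // => ? ? [].
Qed.

(* The witness [y] is the point of [whirl_line j] on no other line. *)
Lemma whirl_exchange i j z : i != j -> z \in whirl_line i ->
  exists2 y, y \in whirl_line j & basis whirl (y |: (whirl_line i :\ z)).
Proof.
(* The test says that [p] lists a transversal whose elements are those of line [i] other than [z],
   together with the private point 4, 0 or 2 of line [j]. *)
pose ok i j z p := [&& uniq p, size p == 3, count [in p] (iota 0 6) == 3,
  all (fun i => whirl_in i (nth 0 p i)) (iota 0 3) &
  all (fun t => (t \in p) == (t == nth 0 [:: 4; 0; 2] j) || (t != z) && ~~ whirl_in i t)
    (iota 0 6)].
have tab : all (fun i => all (fun j => all (fun z =>
    (i != j) && ~~ whirl_in i z ==>
    has (ok i j z) [seq [:: ab.1; ab.2; c] | ab <- [seq (a, b) | a <- iota 0 6, b <- iota 0 6],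
                                              c <- iota 0 6])
    (iota 0 6)) (iota 0 3)) (iota 0 3) by vm_compute.
move=> neq zL; have niz : ~~ whirl_in i z by move: zL; rewrite !inE.
have mem3 (k : 'I_3) : (k : nat) \in iota 0 3 by rewrite mem_iota ltn_ord.
have mem6 (t : 'I_6) : (t : nat) \in iota 0 6 by rewrite mem_iota ltn_ord.
have hyp : ((i : nat) != j) && ~~ whirl_in i z by rewrite val_eqE neq.
have /implyP/(_ hyp)/hasP[p _] := allP (allP (allP tab i (mem3 i)) j (mem3 j)) z (mem6 z).
case/and5P=> up sp cp wp /allP eqp.
have lty : nth 0 [:: 4; 0; 2] j < 6 by case: (j) => [[|[|[|]]]].
exists (Ordinal lty); first by rewrite !inE /=; case: (j) => [[|[|[|]]]].
suff -> : Ordinal lty |: (whirl_line i :\ z) = [set t : 'I_6 | (t : nat) \in p].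
  by apply: whirl_list_basis; rewrite up sp cp wp.
by apply/setP=> t; rewrite !inE (eqP (eqp t (mem6 t))) -!val_eqE.
Qed.

Lemma level1 (T : finType) (s : seq T) z x : uniq s -> level s [set z] x = (z \in take x s).
Proof.
move=> us; rewrite -(count_uniq_mem _ (take_uniq _ us)).
by apply: eq_count => t; rewrite /= inE.
Qed.

Lemma levelD1 (T : finType) (s : seq T) (C : {set T}) z x : uniq s -> z \in C ->
  level s C x = (z \in take x s) + level s (C :\ z) x.
Proof.
move=> us zC; rewrite -{1}(setD1K zC) levelU ?level1 //.
by rewrite disjoints1 !inE eqxx.
Qed.

(* In a lattice path matroid, a dependent triple all of whose pairs extend to bases
   lies in an initial or in a final segment of rank at most 2. Two of the three
   lines of the whirl lie in segments of the same kind, hence so does their union,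
   which however contains a basis. *)
Lemma whirl_not_lattice_path : ~ lattice_path_matroid whirl.
Proof.
move=> /lattice_path_matroid_level[s [r [lo [hi [us memS bas]]]]].
have r3 : r = 3.
  have [B bB] := ex_basis whirl; have [cB _] := (whirl_basis B).1 bB.
  by have [_ <- _] := (bas B).1 bB.
have levB B x : basis whirl B -> x <= size s -> lo x <= level s B x <= hi x.
  by case/bas=> _ _; apply.
pose early i := exists x, [/\ x <= size s, {subset whirl_line i <= take x s} & hi x < 3].
pose late i := exists x, [/\ x <= size s, (forall t, t \in whirl_line i -> t \notin take x s)
                           & 0 < lo x].
have alt i : early i \/ late i.
  have [j neq] : exists j, i != j.
    by exists (if i == ord0 then ord_max else ord0); case: i => [[|[|[|]]]].
  pose C := whirl_line i.
  have /allPn[x] : ~~ all (fun x => lo x <= level s C x <= hi x) (iota 0 (size s).+1).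
    apply/negP=> /allP H; apply: (@whirl_line_nonbasis i); apply/bas.
    rewrite subsetT card_whirl_line r3; split=> // x lex; apply: H.
    by rewrite mem_iota.
  rewrite mem_iota /= add0n ltnS => lex; rewrite negb_and -!ltnNge => /orP[lt|lt].
    (* The line falls below the lower bound. Were [z] among the first [x] elements, exchanging it
       for [y] would not raise the level, and a basis would fall below the bound too. *)
    right; exists x; split=> //; last by apply: leq_ltn_trans lt.
    move=> z zC; apply/negP=> zx; have [y _ bB] := whirl_exchange neq zC.
    have /andP[+ _] := levB _ x bB lex; rewrite leqNgt => /negP; apply.
    apply: leq_ltn_trans lt; rewrite (levelD1 _ us zC) zx.
    have := levelD1 x us (setU11 y (C :\ z)); rewrite -/C => ->.
    apply: leq_add; first exact: leq_b1.
    by apply: level_sub; apply/subsetP=> t; rewrite !inE => /andP[/negbTE->].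
  (* The line exceeds the upper bound. Were [z] not among the first [x] elements, exchanging it
     would not lower the level, and a basis would exceed the bound too. *)
  left; exists x; split=> //.
    move=> z zC; apply: contraT => /negbTE zx; have [y _ bB] := whirl_exchange neq zC.
    have /andP[_] := levB _ x bB lex; rewrite leqNgt => /negP[].
    apply: leq_trans lt _; rewrite (levelD1 _ us zC) zx add0n.
    by apply: level_sub; apply: subsetUr.
  rewrite -(card_whirl_line i); apply: leq_trans lt _; rewrite -/C.
  rewrite level_card ?subset_leq_card //; last by apply/subsetP=> t _; rewrite -memS inE.
  by apply/subsetP=> t; rewrite inE => /andP[].
have sub i j : i != j -> exists2 B, basis whirl B & B \subset whirl_line i :|: whirl_line j.
  move=> neq; have /card_gt0P[z zi] : 0 < #|whirl_line i| by rewrite card_whirl_line.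
  have [y yj bB] := whirl_exchange neq zi; exists (y |: (whirl_line i :\ z)) => //.
  by rewrite subUset sub1set inE yj orbT subsetU // subsetDl.
have take_le x y t : x <= y -> t \in take x s -> t \in take y s.
  by move=> lexy; rewrite -(subnKC lexy) takeD mem_cat => ->.
have noearly i j : i != j -> early i -> early j -> False.
  move=> /sub[B bB sB] [x [lex ix hx]] [y [ley jy hy]].
  (* The longer of the two initial segments contains a whole basis, yet its upper bound is below
     3. *)
  have [z [lez sBz hz]] : exists z, [/\ z <= size s, B \subset take z s & hi z < 3].
    exists (maxn x y); split; first by rewrite geq_max lex.
      apply/subsetP=> t /(subsetP sB); rewrite inE => /orP[/ix|/jy]; apply: take_le.
        exact: leq_maxl.
      exact: leq_maxr.
    by case: (leqP x y).
  have /andP[_] := levB B z bB lez; have [cB _] := (whirl_basis B).1 bB.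
  have := level_size (take_uniq z us) sBz; rewrite /level take_size cB => ->.
  by rewrite leqNgt hz.
have nolate i j : i != j -> late i -> late j -> False.
  move=> /sub[B bB sB] [x [lex ix hx]] [y [ley jy hy]].
  have [z [lez sBz hz]] : exists z, [/\ z <= size s,
      (forall t, t \in B -> t \notin take z s) & 0 < lo z].
    exists (minn x y); split; first by rewrite geq_min lex.
      move=> t /(subsetP sB); rewrite inE => /orP[/ix|/jy]; apply: contra; apply: take_le.
        exact: geq_minl.
      exact: geq_minr.
    by case: (leqP x y).
  have /andP[+ _] := levB B z bB lez.
  suff -> : level s B z = 0 by rewrite leqNgt hz.
  rewrite /level (eq_in_count (a2 := pred0)) ?count_pred0 // => t tz /=.
  by apply/negbTE; apply: contraL tz => /sBz.
have n01 : (ord0 : 'I_3) != inord 1 by rewrite -val_eqE /= inordK.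
have n02 : (ord0 : 'I_3) != ord_max by [].
have n12 : (inord 1 : 'I_3) != ord_max by rewrite -val_eqE /= inordK.
case: (alt ord0) => [e0|l0]; case: (alt (inord 1)) => [e1|l1];
  case: (alt ord_max) => [e2|l2];
  by [case: (noearly _ _ n01 e0 e1) | case: (noearly _ _ n02 e0 e2)
    | case: (noearly _ _ n12 e1 e2) | case: (nolate _ _ n01 l0 l1)
    | case: (nolate _ _ n02 l0 l2) | case: (nolate _ _ n12 l1 l2)].
Qed.

Theorem theorem3p8 :
  (forall (T : finType) (M : matroid T), multi_path M -> multi_path (dual M)) /\
  (forall (T : finType) (M N : matroid T),
     multi_path M -> minor N M -> multi_path N) /\
  (forall (T : finType) (M : matroid T),
     lattice_path_matroid M -> multi_path M) /\
  (exists (T : finType) (M : matroid T),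
     multi_path M /\ ~ lattice_path_matroid M).
Proof.
split=> [T M /multi_path_banded/banded_dual/banded_multi_path //|].
split=> [T M N /multi_path_banded bM /(banded_minor bM)/banded_multi_path //|].
split=> [T M /lattice_path_banded/banded_multi_path //|].
exists 'I_6, whirl; split; last exact: whirl_not_lattice_path.
exact: cyclic_multi_path whirl_cyclic.
Qed.
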